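(* Let $a>0$ and $a_1,a_2\in[0,a]$. Define the open sets $$\diamondsuit(a,a_1,a_2)=\mathrm{int}\big(\mathrm{conv}(([0,a]\times\{a_2\})\cup(\{a_1\}\times[0,a]))\big)\subset\mathbb{R}^2(x),\qquad \square(1)=(0,1)^2\subset\mathbb{R}^2(y),$$ and $B^4_{\sqrt{a/\pi}}=\{z\in\mathbb{R}^4:\pi|z|^2<a\}$. Then $\diamondsuit(a,a_1,a_2)\times\square(1)$ is symplectomorphic to $B^4_{\sqrt{a/\pi}}$.
   Context: $\mathbb{R}^4=\mathbb{R}^2(x)\times\mathbb{R}^2(y)$ with coordinates $(x_1,x_2,y_1,y_2)$ carries the standard symplectic form $\omega=dx_1\wedge dy_1+dx_2\wedge dy_2$; a symplectomorphism between open subsets is a diffeomorphism pulling back $\omega$ to $\omega$. *)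

(* Defs.v *)
From HB Require Import structures.
From mathcomp Require Import all_boot all_order all_algebra.
From mathcomp Require Import all_classical all_reals all_analysis.
Set Implicit Arguments. Unset Strict Implicit. Unset Printing Implicit Defensive.
Import Order.TTheory GRing.Theory Num.Theory.
Import numFieldNormedType.Exports.
Local Open Scope classical_set_scope.
Local Open Scope ring_scope.

(* R^2 is modelled as R * R, R^4 as row vectors 'rV[R]_4 with coordinates
   (x1,x2,y1,y2) = (z 0 0, z 0 1, z 0 2, z 0 3). *)

Section Defs.
Variable R : realType.

Definition convex2 (C : set (R * R)) : Prop :=
  forall p q t, C p -> C q -> 0 <= t -> t <= 1 ->
    C (t * p.1 + (1 - t) * q.1, t * p.2 + (1 - t) * q.2).

Definition conv2 (A : set (R * R)) : set (R * R) :=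
  \bigcap_(C in [set C | convex2 C /\ A `<=` C]) C.

Definition diamond (a a1 a2 : R) : set (R * R) :=
  interior (conv2 ([set p | 0 <= p.1 <= a /\ p.2 = a2] `|`
                   [set p | p.1 = a1 /\ 0 <= p.2 <= a])).

Definition unit_square : set (R * R) :=
  [set p | 0 < p.1 < 1 /\ 0 < p.2 < 1].

Definition c4 (z : 'rV[R]_4) (k : nat) : R := z ord0 (inord k).

Definition diamond_x_square (a a1 a2 : R) : set 'rV[R]_4 :=
  [set z | diamond a a1 a2 (c4 z 0, c4 z 1) /\ unit_square (c4 z 2, c4 z 3)].

Definition ball4 (a : R) : set 'rV[R]_4 :=
  [set z | pi * (\sum_(i < 4) z ord0 i ^+ 2) < a].

(* standard symplectic form  dx1/\dy1 + dx2/\dy2 *)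
Definition omega (u w : 'rV[R]_4) : R :=
  c4 u 0 * c4 w 2 - c4 u 2 * c4 w 0 + c4 u 1 * c4 w 3 - c4 u 3 * c4 w 1.

Fixpoint iter_deriv (vs : seq 'rV[R]_4) (f : 'rV[R]_4 -> 'rV[R]_4)
  : 'rV[R]_4 -> 'rV[R]_4 :=
  match vs with
  | [::] => f
  | v :: vs' => fun x => 'D_v (iter_deriv vs' f) x
  end.

Definition smooth_on (U : set 'rV[R]_4) (f : 'rV[R]_4 -> 'rV[R]_4) : Prop :=
  forall vs : seq 'rV[R]_4, forall x, U x ->
    {for x, continuous (iter_deriv vs f)} /\
    (forall v, derivable (iter_deriv vs f) x v).

Definition preserves_omega (U : set 'rV[R]_4) (f : 'rV[R]_4 -> 'rV[R]_4) : Prop :=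
  forall x, U x -> forall u w, omega ('D_u f x) ('D_w f x) = omega u w.

Definition symplectomorphic (U V : set 'rV[R]_4) : Prop :=
  exists f g : 'rV[R]_4 -> 'rV[R]_4,
    (forall x, U x -> V (f x)) /\ (forall y, V y -> U (g y)) /\
    (forall x, U x -> g (f x) = x) /\ (forall y, V y -> f (g y) = y) /\
    smooth_on U f /\ smooth_on V g /\ preserves_omega U f.

End Defs.

(* Main.v *)
(** The ball and the diamond times the square are both charted explicitly by
    R^4, with coordinates p = (x1, x2, t1, t2), and the two charts pull omega
    back to the same 2-form; composing one with the inverse of the other gives
    the symplectomorphism.

    Put s_i = sqrt(1 + x_i^2 + t_i^2) and b_i = 1 - 2 a_i / a.  On the strip
    0 < Y_i < 1 the Hamiltonian s_i = sqrt(x_i^2 + 1 / sin^2(pi Y_i)) is an affine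
    function of its action; adding b_i s_i to the
    momentum x_i shifts the limiting box [-s, s] to [-2 a_i s / a, 2 (1 - a_i / a) s].
    Rescaling the total momentum by 1 / (s1 + s2) fills the diamond:
      diamond chart:  X_i = a_i + (a/2) (b_i s_i + x_i) / (s1 + s2),
                      Y_i = 1/2 + atan(t_i) / pi.
    In action-angle coordinates (z_i = X_i + i Y_i) the same data become
      ball chart:     z_1 = k_1 e^(i nu) (x1 + i t1),  z_2 = k_2 e^(-i nu) (x2 + i t2),
                      k_i^2 = a / (pi (s1 + s2) (s_i + 1)),
    where 2 nu = n_1 - n_2 and n_i = atan(x_i t_i / (1 + t_i^2 + s_i)) + b_i atan(t_i)
    solves s_i dn_i = (b_i s_i + x_i) d(atan t_i) - (x_i dt_i - t_i dx_i) / (s_i + 1).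
    Inverting the ball chart amounts to solving one monotone equation for nu,
    inverting the diamond chart to solving one equation between quadratics for
    s1 / (s1 + s2). *)
Require Import Defs.
From HB Require Import structures.
From mathcomp Require Import all_boot all_order all_algebra.
From mathcomp Require Import all_classical all_reals all_analysis.
From mathcomp Require Import ring lra.
Import Order.TTheory GRing.Theory Num.Theory.
Import numFieldNormedType.Exports.
Set Implicit Arguments. Unset Strict Implicit. Unset Printing Implicit Defensive.
Local Open Scope classical_set_scope.
Local Open Scope ring_scope.

(** * Scalar functions of class C^k on an open set of a normed space *)

Section Smooth.
Variable R : realType.

(** This epsilon criterion lets a differential be read off from a norm estimate, as is done below
    for inverse maps. *)
Lemma is_diff_littleo (V W : normedModType R) (f : V -> W) (L : {linear V -> W}) x :
  continuous L ->
  (forall e, 0 < e -> \forall y \near x, `|f y - f x - L (y - x)| <= e * `|y - x|) ->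
  is_diff x f L.
Proof.
move=> Lc H.
have E : f \o shift x = cst (f x) + L +o_ 0 id.
  apply/eqaddoP => e e0; have := H e e0.
  by rewrite (near_shift 0 x) subr0; apply: filterS => h /=; rewrite addrK opprD addrA.
have D : 'd f x = L :> (V -> W) by exact: diff_unique.
by apply: DiffDef => //; apply/diff_locallyP; rewrite D.
Qed.

Lemma diff_littleo (V W : normedModType R) (f : V -> W) x e :
  differentiable f x -> 0 < e ->
  \forall y \near x, `|f y - f x - 'd f x (y - x)| <= e * `|y - x|.
Proof.
move=> /diff_locallyP[_ /eqaddoP H] e0.
rewrite (near_shift 0 x) subr0; apply: filterS (H e e0) => h /=.
by rewrite addrK opprD addrA.
Qed.

Lemma is_diff_near_eq (V W : normedModType R) (f g : V -> W) x :
  {near x, f =1 g} -> differentiable f x -> is_diff x g ('d f x).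
Proof.
move=> fg df; apply: is_diff_littleo; first exact: diff_continuous.
move=> e e0; near=> y.
rewrite -(nbhs_singleton fg).
have <- : f y = g y by near: y.
near: y; exact: diff_littleo.
Unshelve. all: by end_near. Qed.

Variable V : normedModType R.
Implicit Types (f g : V -> R).

(** Derivatives are taken along constant vectors, to match [iter_deriv]; Frechet differentiability
    at every level before the last keeps the chain rule available. *)
Fixpoint Ck k (U : set V) f : Prop :=
  match k with
  | 0%N => forall x, U x -> {for x, continuous f}
  | k'.+1 => (forall x, U x -> differentiable f x) /\ forall v, Ck k' U ('D_v f)
  end.

Definition smooth (U : set V) f : Prop := forall k, Ck k U f.

Variable U : set V.
Hypothesis Uo : open U.

(** Since U is open, f and g agree near each of its points, so their derivatives agree too. This
    allows a derivative to be replaced by a formula valid only on U. *)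
Lemma Ck_eq k f g : (forall x, U x -> f x = g x) -> Ck k U f -> Ck k U g.
Proof.
have near_fg h1 h2 x : (forall x, U x -> h1 x = h2 x) -> U x -> {near x, h1 =1 h2 :> (V -> R)}.
  by move=> E Ux; apply: filterS (open_nbhs_nbhs (conj Uo Ux)) => y; apply: E.
elim: k f g => [|k IH] f g fg /=.
  move=> cf x Ux; rewrite /prop_for /continuous_at -(fg x Ux).
  by apply: cvg_trans (cf x Ux); apply: near_eq_cvg; apply: filterS (near_fg _ _ _ fg Ux).
move=> [df Df]; have dg x (Ux : U x) := is_diff_near_eq (near_fg _ _ _ fg Ux) (df x Ux).
split=> [x Ux|v]; first by have [] := dg x Ux.
apply: IH (Df v) => x Ux; have [dgx E] := dg x Ux.
apply: (eq_trans (deriveE v (df x Ux))); apply: esym.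
by apply: (eq_trans (deriveE v dgx)); rewrite E.
Qed.

Lemma Ck_continuous k f : Ck k U f -> forall x, U x -> {for x, continuous f}.
Proof. by case: k => //= k [df _] x Ux; apply/differentiable_continuous/df. Qed.

Lemma CkW k f : Ck k.+1 U f -> Ck k U f.
Proof.
elim: k f => [|k IH] f [df Df].
  by move=> x Ux; exact/differentiable_continuous/df.
by split=> // v; exact: IH.
Qed.

Lemma Ck_cst k (c : R) : Ck k U (fun=> c).
Proof.
elim: k c => [|k IH] c /=; first by move=> x _; exact: cst_continuous.
split=> [x _|v]; first exact: differentiable_cst.
by apply: Ck_eq (IH 0) => x _; rewrite (derive_cst c).
Qed.

Lemma CkD k f g : Ck k U f -> Ck k U g -> Ck k U (fun x => f x + g x).
Proof.
elim: k f g => [|k IH] f g /=.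
  by move=> cf cg x Ux; apply: continuousD; [exact: cf|exact: cg].
move=> [df Df] [dg Dg]; split=> [x Ux|v].
  by apply: (@differentiableD _ _ _ f g); [exact: df|exact: dg].
apply: Ck_eq (IH _ _ (Df v) (Dg v)) => x Ux.
by rewrite (@deriveD _ _ _ f g)//; apply: diff_derivable; [exact: df|exact: dg].
Qed.

Lemma CkM k f g : Ck k U f -> Ck k U g -> Ck k U (fun x => f x * g x).
Proof.
elim: k f g => [|k IH] f g.
  by move=> cf cg x Ux; apply: continuousM; [exact: cf|exact: cg].
move=> cf cg; have [cf' cg'] := (CkW cf, CkW cg).
move: cf cg => [df Df] [dg Dg]; split=> [x Ux|v].
  by apply: (@differentiableM _ _ f g); [exact: df|exact: dg].
apply: Ck_eq (CkD (IH _ _ cf' (Dg v)) (IH _ _ cg' (Df v))) => x Ux.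
by rewrite (@deriveM _ _ f g)//; apply: diff_derivable; [exact: df|exact: dg].
Qed.

Lemma CkN k f : Ck k U f -> Ck k U (fun x => - f x).
Proof.
move=> cf; apply: (@Ck_eq _ (fun x => -1 * f x)) => [x _|]; first by rewrite mulN1r.
by apply: CkM => //; exact: Ck_cst.
Qed.

Lemma CkB k f g : Ck k U f -> Ck k U g -> Ck k U (fun x => f x - g x).
Proof. by move=> cf cg; apply: CkD => //; exact: CkN. Qed.

Lemma Ck_sqr k f : Ck k U f -> Ck k U (fun x => f x ^+ 2).
Proof. by move=> cf; exact: CkM. Qed.

(** The assumption on [dphi] is one order weaker than the conclusion, which suits inductions on k
    where the derivative of phi is again expressed through phi. *)
Lemma Ck_comp1 k (phi dphi : R -> R) f :
  (forall x, U x -> is_derive (f x) 1 phi (dphi (f x))) ->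
  Ck k.+1 U f -> Ck k U (fun x => dphi (f x)) ->
  Ck k.+1 U (fun x => phi (f x)).
Proof.
move=> dphiP [df Df] cphi.
have dphi1 x : U x -> differentiable phi (f x).
  by move=> Ux; apply/derivable1_diffP; have [] := dphiP x Ux.
split=> [x Ux|v].
  by apply: (@differentiable_comp _ _ _ _ f phi); [exact: df|exact: dphi1].
apply: Ck_eq (CkM (Df v) cphi) => x Ux.
have [dx dp] := (df x Ux, dphi1 x Ux).
rewrite [in RHS]deriveE; last exact: (@differentiable_comp _ _ _ _ f phi).
rewrite (@diff_comp _ _ _ _ f phi)//= (deriveE v dx) (diff1E dp) derive1E.
by have [_ ->] := dphiP x Ux.
Qed.

Lemma CkV k f : (forall x, U x -> f x != 0) -> Ck k U f -> Ck k U (fun x => (f x)^-1).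
Proof.
move=> f0; elim: k => [|k IH].
  by move=> cf x Ux; apply: (continuousV (f0 x Ux)); exact: cf.
move=> cf; apply: (@Ck_comp1 _ _ (fun y => -1 * (y^-1 * y^-1))) => // [x Ux|].
  apply: is_derive_eq (is_deriveV (f0 _ Ux) (is_derive_id _ _)) _.
  by rewrite [RHS]mulN1r /GRing.scale /= mulr1 -invfM -expr2.
by apply: CkM; [exact: Ck_cst|apply: CkM; apply: IH; exact: CkW].
Qed.

Lemma Ck_sqrt k f : (forall x, U x -> 0 < f x) -> Ck k U f ->
  Ck k U (fun x => Num.sqrt (f x)).
Proof.
move=> f0; elim: k => [|k IH].
  by move=> cf x Ux; apply: (continuous_comp (cf x Ux)); exact: sqrt_continuous.
move=> cf; apply: (@Ck_comp1 _ _ (fun y => (2 * Num.sqrt y)^-1)) => // [x Ux|].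
  exact/is_derive1_sqrt/f0.
apply: CkV => [x Ux|]; first by rewrite mulf_neq0 // gt_eqF // sqrtr_gt0 f0.
by apply: CkM; [exact: Ck_cst|apply: IH; exact: CkW].
Qed.

Lemma Ck_atan k f : Ck k U f -> Ck k U (fun x => atan (f x)).
Proof.
case: k => [|k].
  by move=> cf x Ux; apply: (continuous_comp (cf x Ux)); exact: continuous_atan.
move=> cf; apply: (@Ck_comp1 _ _ (fun y => (1 + y * y)^-1)) => //.
apply: CkV => [x Ux|]; first by rewrite -expr2 gt_eqF // ltr_pwDl // sqr_ge0.
by apply: CkD; [exact: Ck_cst|apply: CkM; exact: CkW].
Qed.

(** Both claims go through one induction because the derivative of each function involves the
    other. *)
Lemma Ck_sin_cos k f : Ck k U f ->
  Ck k U (fun x => sin (f x)) /\ Ck k U (fun x => cos (f x)).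
Proof.
elim: k => [|k IH].
  by move=> cf; split=> x Ux; apply: (continuous_comp (cf x Ux));
    [exact: continuous_sin|exact: continuous_cos].
move=> cf; have [cs cc] := IH (CkW cf); split.
  by apply: (@Ck_comp1 _ _ cos) => // x _; exact: is_derive_sin.
apply: (@Ck_comp1 _ _ (fun y => -1 * sin y)) => // [x _|].
  by rewrite mulN1r; exact: is_derive_cos.
by apply: CkM => //; exact: Ck_cst.
Qed.

Lemma Ck_linear k (L : {linear V -> R}) : continuous L -> Ck k U L.
Proof.
case: k => [|k] Lc; first by move=> x _; exact: Lc.
split=> [x _|v]; first exact: linear_differentiable.
apply: Ck_eq (Ck_cst k (L v)) => x _.
by rewrite deriveE ?diff_lin //; exact: linear_differentiable.
Qed.

Lemma Ck_sum k (I : Type) (r : seq I) (F : I -> V -> R) :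
  (forall i, Ck k U (F i)) -> Ck k U (fun x => \sum_(i <- r) F i x).
Proof.
move=> cF; elim: r => [|i r IH].
  by apply: Ck_eq (Ck_cst k 0) => x _; rewrite big_nil.
by apply: Ck_eq (CkD (cF i) IH) => x _; rewrite big_cons.
Qed.

Lemma Ck_prod k (I : Type) (r : seq I) (F : I -> V -> R) :
  (forall i, Ck k U (F i)) -> Ck k U (fun x => \prod_(i <- r) F i x).
Proof.
move=> cF; elim: r => [|i r IH].
  by apply: Ck_eq (Ck_cst k 1) => x _; rewrite big_nil.
by apply: Ck_eq (CkM (cF i) IH) => x _; rewrite big_cons.
Qed.

Lemma Ck_det k n (A : V -> 'M[R]_n) :
  (forall i j, Ck k U (fun x => A x i j)) -> Ck k U (fun x => \det (A x)).
Proof.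
move=> cA; apply: Ck_sum => s; apply: CkM; first exact: Ck_cst.
by apply: Ck_prod => i; exact: cA.
Qed.

(** Cramer's formula: each entry of the inverse is a cofactor divided by the determinant. *)
Lemma Ck_invmx k n (A : V -> 'M[R]_n) i j :
  (forall x, U x -> A x \in unitmx) ->
  (forall i j, Ck k U (fun x => A x i j)) -> Ck k U (fun x => invmx (A x) i j).
Proof.
move=> uA cA.
apply: (@Ck_eq _ (fun x => (\det (A x))^-1 * ((-1) ^+ (j + i) * \det (row' j (col' i (A x)))))).
  by move=> x Ux; rewrite /invmx uA // !mxE.
apply: CkM.
  by apply: CkV; [move=> x /uA; rewrite unitmxE unitfE|exact: Ck_det].
apply: CkM; first exact: Ck_cst.
apply: Ck_det => i' j'; apply: Ck_eq (cA (lift j i') (lift i j')) => x _.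
by rewrite !mxE.
Qed.

End Smooth.

(** * Smooth maps between spaces of row vectors, treated coordinate by coordinate *)

Section RowVectors.
Variable R : realType.

Definition smooth_rV (V : normedModType R) n (U : set V) (F : V -> 'rV[R]_n) : Prop :=
  forall j, smooth U (fun x => F x 0 j).

Lemma differentiable_rV (V : normedModType R) n (F : V -> 'rV[R]_n) x :
  (forall j, differentiable (fun y => F y 0 j) x) -> differentiable F x.
Proof.
move=> dF; rewrite (_ : F = \sum_j (fun y => F y 0 j *: delta_mx 0 j)).
  by apply: differentiable_sum => j; exact: differentiableZl.
by apply/funext => y; rewrite fct_sumE -row_sum_delta.
Qed.

Lemma derive_rV (V : normedModType R) n (F : V -> 'rV[R]_n) x v j :
  differentiable F x -> 'D_v F x 0 j = 'D_v (fun y => F y 0 j) x.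
Proof. by move=> dF; rewrite derive_mx ?mxE//; exact: diff_derivable. Qed.

Lemma smooth_differentiable (V : normedModType R) (U : set V) (f : V -> R) x :
  smooth U f -> U x -> differentiable f x.
Proof. by move=> /(_ 1%N)[df _]; exact: df. Qed.

Lemma smooth_rV_differentiable (V : normedModType R) n (U : set V) (F : V -> 'rV[R]_n) x :
  smooth_rV U F -> U x -> differentiable F x.
Proof.
by move=> cF Ux; apply: differentiable_rV => j; exact: smooth_differentiable (cF j) Ux.
Qed.

Lemma smooth_rV_derive (V : normedModType R) n (U : set V) (F : V -> 'rV[R]_n) v :
  open U -> smooth_rV U F -> smooth_rV U ('D_v F).
Proof.
move=> Uo cF j k; have [_ /(_ v)] := cF j k.+1.
apply: (Ck_eq Uo) => x Ux; rewrite derive_rV//.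
exact: smooth_rV_differentiable cF Ux.
Qed.

Lemma smooth_on_rV (U : set 'rV[R]_4) (F : 'rV[R]_4 -> 'rV[R]_4) :
  open U -> smooth_rV U F -> smooth_on U F.
Proof.
move=> Uo cF vs x Ux.
have cvs : smooth_rV U (iter_deriv vs F).
  by elim: vs => //= v vs; exact: smooth_rV_derive.
have dvs := smooth_rV_differentiable cvs Ux.
by split=> [|v]; [exact: differentiable_continuous|exact: diff_derivable].
Qed.

Lemma derive_sum_delta (V : normedModType R) n (f : 'rV[R]_n -> V) x u :
  differentiable f x -> 'D_u f x = \sum_i u 0 i *: 'D_(delta_mx 0 i) f x.
Proof.
move=> df; rewrite deriveE// {1}[u]row_sum_delta linear_sum.
by apply: eq_bigr => i _; rewrite linearZ deriveE.
Qed.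

(** The derivative of f o G is the sum of D_v G_i times (d_i f) o G, so the induction must range
    over all f. Only C^k is asked of G, so that the lemma can serve while the regularity of G is
    still being raised. *)
Lemma Ck_comp_rV (V : normedModType R) n k (U : set V) (W : set 'rV[R]_n)
    (G : V -> 'rV[R]_n) (f : 'rV[R]_n -> R) :
  open U -> (forall x, U x -> W (G x)) -> (forall x, U x -> {for x, continuous G}) ->
  (forall j, Ck k U (fun x => G x 0 j)) -> smooth W f -> Ck k U (fun x => f (G x)).
Proof.
move=> Uo UW Gc; elim: k f => [|k IH] f cG cf.
  move=> x Ux; apply: (continuous_comp (Gc x Ux)).
  exact: Ck_continuous (cf 0%N) _ (UW x Ux).
have dG x : U x -> differentiable G x.
  by move=> Ux; apply: differentiable_rV => j; have [+ _] := cG j; exact.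
have df x : U x -> differentiable f (G x) by move=> /UW; exact: smooth_differentiable.
split=> [x Ux|v].
  by apply: (@differentiable_comp _ _ _ _ G f); [exact: dG|exact: df].
apply: (@Ck_eq _ _ _ Uo _
  (fun x => \sum_i 'D_v (fun y => G y 0 i) x * 'D_(delta_mx 0 i) f (G x))).
  move=> x Ux; have [dGx dfx] := (dG x Ux, df x Ux).
  rewrite [RHS]deriveE; last exact: (@differentiable_comp _ _ _ _ G f).
  rewrite (@diff_comp _ _ _ _ G f)//= -deriveE// derive_sum_delta//.
  by apply: eq_bigr => i _; rewrite -deriveE// derive_rV.
apply: (Ck_sum Uo) => i; apply: (CkM Uo); first by have [_ /(_ v)] := cG i.
apply: (IH ('D_(delta_mx 0 i) f)) => [j|j]; first exact: (CkW (cG j)).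
by have [_] := cf j.+1; exact.
Qed.

Lemma smooth_comp_rV (V : normedModType R) n m (U : set V) (W : set 'rV[R]_n)
    (G : V -> 'rV[R]_n) (F : 'rV[R]_n -> 'rV[R]_m) :
  open U -> (forall x, U x -> W (G x)) ->
  smooth_rV U G -> smooth_rV W F -> smooth_rV U (F \o G).
Proof.
move=> Uo UW cG cF j k.
apply: (@Ck_comp_rV _ _ k U W G (fun y => F y 0 j)) => // [x Ux|i].
  exact/differentiable_continuous/(smooth_rV_differentiable cG).
exact: cG.
Qed.

Lemma Ck_coord n k (U : set 'rV[R]_n) i : open U -> Ck k U (fun x => x 0 i).
Proof.
move=> Uo; have @f : {linear 'rV[R]_n -> R}.
  by exists (fun N : 'rV[R]_n => N 0 i); do 2![eexists]; do ?[constructor];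
     rewrite ?mxE// => ? *; rewrite ?mxE//; move=> ?; rewrite !mxE.
rewrite (_ : (fun _ => _) = f) //.
by apply: (Ck_linear Uo); exact: coord_continuous.
Qed.

Lemma continuous_mulmxr n m (A : 'M[R]_(n, m)) : continuous (mulmxr A : 'rV[R]_n -> 'rV[R]_m).
Proof.
move=> h; apply: differentiable_continuous; apply: differentiable_rV => j.
apply: (@smooth_differentiable _ setT) => // k.
apply: (@Ck_eq _ _ _ openT _ (fun h : 'rV[R]_n => \sum_i h 0 i * A i j)) => [x _|].
  by rewrite mxE.
apply: (Ck_sum openT) => i; apply: (CkM openT); last exact: (Ck_cst openT).
exact: (Ck_coord _ _ openT).
Qed.

(** * Regularity of a right inverse of an immersion between spaces of equal dimension *)

Lemma jacobian_unit n (F : 'rV[R]_n -> 'rV[R]_n) x : differentiable F x ->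
  (forall u, 'D_u F x = 0 -> u = 0) -> 'J F x \in unitmx.
Proof.
move=> dF iF; rewrite -row_free_unit; apply: inj_row_free => u.
by rewrite -deriveEjacobian// => /iF.
Qed.

Lemma is_diff_right_inverse n (F G : 'rV[R]_n -> 'rV[R]_n) y :
  differentiable F (G y) -> (forall u, 'D_u F (G y) = 0 -> u = 0) ->
  {for y, continuous G} -> (\forall z \near y, F (G z) = z) ->
  is_diff y G (mulmxr (invmx ('J F (G y)))).
Proof.
move=> dF iF Gc FG; set P := invmx _.
have JP u : 'd F (G y) u *m P = u.
  by rewrite -(deriveE _ dF) deriveEjacobian// mulmxK// jacobian_unit.
apply: is_diff_littleo; first exact: continuous_mulmxr.
move=> e e0.
have [k k0 kP] := linear_lipschitz (@continuous_mulmxr n n P).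
(* The first bound gives |P r| <= |G z - G y| / 2, hence |G z - G y| <= 2 k |z - y|; the second then
   turns k |r| into e |z - y|. *)
have m0 : 0 < Order.min (2 * k)^-1 (e / (2 * k ^+ 2)).
  by rewrite lt_min invr_gt0 divr_gt0// ?mulr_gt0// exprn_gt0.
have := Gc _ (diff_littleo dF m0); rewrite nbhs_simpl /= => H.
near=> z.
have Fz : F (G z) = z by near: z.
have Fy : F (G y) = y by exact: nbhs_singleton FG.
have : `|F (G z) - F (G y) - 'd F (G y) (G z - G y)| <=
  Order.min (2 * k)^-1 (e / (2 * k ^+ 2)) * `|G z - G y| by near: z.
rewrite Fz Fy; set r := _ - 'd F _ _ => hr.
have rP : mulmxr P r = mulmxr P (z - y) - (G z - G y).
  by rewrite /= /r mulmxBl JP.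
have h1 : k * `|r| <= `|G z - G y| / 2.
  have h : `|r| <= (2 * k)^-1 * `|G z - G y|.
    by apply: le_trans hr _; rewrite ler_wpM2r// ge_min lexx.
  apply: le_trans (ler_wpM2l (ltW k0) h) _.
  by rewrite invfM mulrA mulrCA divff ?gt_eqF// mulr1 mulrC.
have h2 : `|G z - G y| <= 2 * k * `|z - y|.
  have : `|G z - G y| <= `|mulmxr P (z - y)| + `|mulmxr P r|.
    rewrite (_ : G z - G y = mulmxr P (z - y) - mulmxr P r) ?ler_normB//.
    by rewrite rP; apply/esym; rewrite subKr.
  have := kP (z - y); have := kP r; lra.
rewrite (_ : G z - G y - _ = - mulmxr P r) ?normrN; last by rewrite rP opprB.
apply: le_trans (kP r) _.
have h3 : `|r| <= e / (2 * k ^+ 2) * `|G z - G y|.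
  by apply: le_trans hr _; rewrite ler_wpM2r// ge_min lexx orbT.
apply: le_trans (ler_wpM2l (ltW k0) h3) _.
have h4 : 0 <= e / (2 * k) by rewrite divr_ge0 ?mulr_ge0 ?ltW.
have := ler_wpM2l h4 h2.
rewrite (_ : k * (e / (2 * k ^+ 2) * `|G z - G y|) = e / (2 * k) * `|G z - G y|); last first.
  by field; rewrite gt_eqF.
rewrite (_ : e / (2 * k) * (2 * k * `|z - y|) = e * `|z - y|) //.
by field; rewrite gt_eqF.
Unshelve. all: by end_near. Qed.

(** Bootstrapping: DG is the inverse of the Jacobian of F taken at G, so G of class C^k makes DG of
    class C^k and G of class C^(k+1). *)
Lemma smooth_right_inverse n (V : set 'rV[R]_n) (F G : 'rV[R]_n -> 'rV[R]_n) :
  open V -> smooth_rV setT F -> (forall x u, 'D_u F x = 0 -> u = 0) ->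
  (forall y, V y -> {for y, continuous G}) -> (forall y, V y -> F (G y) = y) ->
  smooth_rV V G.
Proof.
move=> Vo cF iF Gc FG.
have dF x : differentiable F x by exact: smooth_rV_differentiable cF _.
have dG y (Vy : V y) : is_diff y G (mulmxr (invmx ('J F (G y)))).
  apply: is_diff_right_inverse (dF _) (iF _) (Gc _ Vy) _.
  by apply: filterS (open_nbhs_nbhs (conj Vo Vy)) => z; exact: FG.
move=> j k; elim: k j => [|k IH] j.
  move=> y Vy; exact: (continuous_comp (Gc y Vy) (@coord_continuous R 1 n 0 j (G y))).
split=> [y Vy|v].
  have [dGy _] := dG y Vy.
  apply: (@differentiable_comp _ _ _ _ G (fun N : 'rV[R]_n => N 0 j)) => //.
  exact: differentiable_coord.
apply: (@Ck_eq _ _ _ Vo _ (fun y => \sum_i v 0 i * invmx ('J F (G y)) i j)).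
  move=> y Vy; have [dGy E] := dG y Vy.
  by rewrite -derive_rV// deriveE// E /= mxE.
apply: (Ck_sum Vo) => i; apply: (CkM Vo); first exact: (Ck_cst Vo).
apply: (Ck_invmx Vo) => [y Vy|i' j']; first exact: (jacobian_unit (dF _) (iF _)).
apply: (@Ck_eq _ _ _ Vo _ (fun y => 'D_(delta_mx 0 i') (fun z => F z 0 j') (G y))).
  move=> y Vy; rewrite -derive_rV// deriveEjacobian//.
  by rewrite -rowE mxE.
apply: (@Ck_comp_rV _ _ k V setT G ('D_(delta_mx 0 i') (fun z => F z 0 j'))) => // m.
by have [_] := cF j' m.+1; exact.
Qed.

(* Values of G near y stay in a compact ball, and F (G y) = y leaves them a single cluster point. *)
Lemma continuous_right_inverse n (F G : 'rV[R]_n -> 'rV[R]_n) (y : 'rV[R]_n) (M : R) :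
  continuous F -> injective F -> (\forall z \near y, F (G z) = z) ->
  (\forall z \near y, `|G z| <= M) -> {for y, continuous G}.
Proof.
move=> Fc Fi FG GM.
have GMy := nbhs_singleton GM.
(* The radius M + 1, rather than M, makes K a neighbourhood of G y. *)
pose K := [set x : 'rV[R]_n | `|x| <= M + 1].
apply: (@compact_cluster_set1 _ (G y) (G @ y) K).
- exact: norm_hausdorff.
- apply: bounded_closed_compact.
    by exists (M + 1); split=> [|r hr x /= hx]; [exact: num_real|exact: le_trans (ltW hr)].
  rewrite (_ : K = (fun x : 'rV[R]_n => `|x|) @^-1` [set r | r <= M + 1]) //.
  by apply: closed_comp => [x _|]; [exact: norm_continuous|exact: closed_le].
- apply/nbhs_ballP; exists 1 => //= x; rewrite -ball_normE /= => h.
  have := ler_normB (G y) (G y - x); rewrite opprB addrC subrK /K/= => h'.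
  by rewrite (le_trans h')// lerD// ltW.
- apply: fmap_proper_filter; exact: nbhs_pfilter.
- by apply: filterS GM => z /= hz; rewrite /K/=; lra.
apply/seteqP; split=> [p clp|p -> A B GA]; last first.
  move=> /nbhs_singleton GyB; exists (G y); split => //.
  exact: nbhs_singleton GA.
apply: Fi; rewrite (nbhs_singleton FG).
apply/esym/norm_hausdorff => A B yA FB.
have GA : (G @ y) (G @` (A `&` [set z | F (G z) = z])).
  apply: filterS (filterI yA FG) => z hz.
  by exists z.
have [_ [[z [Az /= FGz] <-] Bz]] := clp _ _ GA (Fc p B FB).
by exists z; split=> //; rewrite -FGz.
Qed.

End RowVectors.

(** * Directional derivatives of elementary expressions *)

Section Calculus.
Variable R : realType.

(** Of f only the derivative along u is given, so the claim is reduced to the one-variable chain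
    rule on the line h -> f (h u + x). *)
Lemma is_derive_comp1 (V : normedModType R) (phi : R -> R) (f : V -> R) x u d df :
  is_derive (f x) 1 phi d -> is_derive x u f df ->
  is_derive x u (fun y => phi (f y)) (d * df).
Proof.
move=> [dphi Ephi] [dfx Ef].
pose g h := f (h *: u + x).
have line (F : V -> R) : 'D_u F x = 'D_1 (fun h : R => F (h *: u + x)) 0.
  rewrite /derive; set g1 := fun h => h^-1 *: _; set g2 := fun h => h^-1 *: _.
  suff -> : g1 = g2 by [].
  by apply/funext => h; rewrite /g1 /g2 /= addr0 scale0r add0r [_%:A]mulr1.
have dg : derivable g 0 1 by have [/(_ dfx)] := derivable1P f x u.
have g0 : g 0 = f x by rewrite /g scale0r add0r.
have dphig : derivable phi (g 0) 1 by rewrite g0; exact: dphi.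
split.
  have [_] := derivable1P (fun y => phi (f y)) x u; apply; apply/derivable1_diffP.
  by apply: (@differentiable_comp _ _ _ _ g phi); apply/derivable1_diffP.
rewrite line -derive1E (@derive1_comp _ g phi 0 dg dphig).
by rewrite g0 !derive1E Ephi -Ef line.
Qed.

Section Pointwise.
Variables (V : normedModType R) (p u : V) (f g : V -> R) (df dg : R).
Hypotheses (Df : is_derive p u f df) (Dg : is_derive p u g dg).

Lemma is_derive_add : is_derive p u (fun q => f q + g q) (df + dg).
Proof. exact: is_deriveD. Qed.

Lemma is_derive_sub : is_derive p u (fun q => f q - g q) (df - dg).
Proof. exact: is_deriveB. Qed.

Lemma is_derive_mul : is_derive p u (fun q => f q * g q) (f p * dg + g p * df).
Proof. exact: is_deriveM. Qed.

Lemma is_derive_div : g p != 0 ->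
  is_derive p u (fun q => f q / g q) ((df * g p - f p * dg) / g p ^+ 2).
Proof.
move=> g0; have [df' Ef] := Df; have [dg' Eg] := Dg.
have dV : derivable (fun q => (g q)^-1) p u by exact: derivableV.
split; first exact: (derivableM df' dV).
apply: (eq_trans (deriveM df' dV)); rewrite (deriveV g0 dg') Ef Eg /GRing.scale/=.
by field.
Qed.

Lemma is_derive_atan : is_derive p u (fun q => atan (f q)) (df / (1 + f p ^+ 2)).
Proof. by rewrite mulrC; exact: is_derive_comp1 (is_derive1_atan _) Df. Qed.

Lemma is_derive_cos_comp : is_derive p u (fun q => cos (f q)) (- sin (f p) * df).
Proof. exact: is_derive_comp1 (is_derive_cos _) Df. Qed.

Lemma is_derive_sin_comp : is_derive p u (fun q => sin (f q)) (cos (f p) * df).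
Proof. exact: is_derive_comp1 (is_derive_sin _) Df. Qed.

Lemma is_derive_sqrt_comp : 0 < f p ->
  is_derive p u (fun q => Num.sqrt (f q)) (df / (2 * Num.sqrt (f p))).
Proof. by move=> f0; rewrite mulrC; exact: is_derive_comp1 (is_derive1_sqrt f0) Df. Qed.

Lemma is_derive_const (c : R) : is_derive p u (fun=> c) 0.
Proof. exact: is_derive_cst. Qed.

End Pointwise.

(** * The functions [hyp] and [lag], their derivatives and their behaviour under rotation *)

Definition hyp (x t : R) : R := Num.sqrt (1 + x ^+ 2 + t ^+ 2).
(** The argument of the complex number (1 + t^2 + s) + i x t, where s = [hyp x t]; its real part is
    positive. *)
Definition lag (x t : R) : R := atan (x * t / (1 + t ^+ 2 + hyp x t)).

Lemma sqr_hyp x t : hyp x t ^+ 2 = 1 + x ^+ 2 + t ^+ 2.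
Proof. by rewrite sqr_sqrtr// !addr_ge0// sqr_ge0. Qed.

Lemma hyp_ge1 x t : 1 <= hyp x t.
Proof.
rewrite -(@ler_pXn2r _ 2)// ?nnegrE ?sqrtr_ge0//.
by rewrite sqr_hyp expr1n -addrA lerDl addr_ge0// sqr_ge0.
Qed.

Lemma hyp_gt0 x t : 0 < hyp x t.
Proof. exact: lt_le_trans ltr01 (hyp_ge1 x t). Qed.

Lemma hyp_uniq x t s : 0 < s -> s ^+ 2 = 1 + x ^+ 2 + t ^+ 2 -> hyp x t = s.
Proof. by move=> s0 hs; rewrite /hyp -hs sqrtr_sqr gtr0_norm. Qed.

Lemma ltr_norm_hyp x t : `|x| < hyp x t.
Proof.
rewrite -(@ltr_pXn2r _ 2)// ?nnegrE ?sqrtr_ge0// sqr_hyp real_normK ?num_real//.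
by rewrite addrAC ltrDr ltr_pwDl// sqr_ge0.
Qed.

(** Here |b x| <= |x| < s. This positivity drives both the uniqueness of the rotation angle and the
    injectivity of the diamond chart. *)
Lemma hyp_slope_gt0 b x t : -1 <= b <= 1 -> 0 < hyp x t + b * x.
Proof.
rewrite -ler_norml => hb.
have : `|b * x| < hyp x t.
  by apply: le_lt_trans (ltr_norm_hyp x t); rewrite normrM ler_piMl.
by rewrite ltr_norml => /andP[+ _]; rewrite -subr_gt0 opprK addrC.
Qed.

(** The squared modulus of the complex number whose argument is [lag]; it arises when the arctangent
    is differentiated. *)
Lemma lag_denom x t : 
  (1 + t ^+ 2 + hyp x t) ^+ 2 + (x * t) ^+ 2 = (1 + t ^+ 2) * (hyp x t + 1) ^+ 2.
Proof.
apply/eqP; rewrite -subr_eq0; apply/eqP.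
(* The relation s^2 = 1 + x^2 + t^2 is used by exhibiting it as a factor of the difference of the
   two sides; later identities in s follow the same pattern. *)
rewrite (_ : _ - _ = t ^+ 2 * (1 + x ^+ 2 + t ^+ 2 - hyp x t ^+ 2)); last ring.
by rewrite sqr_hyp subrr mulr0.
Qed.

Section Along.
Variables (V : normedModType R) (p u : V) (X T : V -> R) (dx dt : R).
Hypotheses (DX : is_derive p u X dx) (DT : is_derive p u T dt).
Let x := X p.
Let t := T p.
Let s := hyp x t.

Lemma is_derive_hyp : is_derive p u (fun q => hyp (X q) (T q)) ((x * dx + t * dt) / s).
Proof.
have D := is_derive_add (is_derive_add (is_derive_const p u 1) (is_derive_mul DX DX))
  (is_derive_mul DT DT).
have sq0 : 0 < 1 + X p * X p + T p * T p.
  by rewrite -!expr2 -addrA ltr_pwDl// addr_ge0// sqr_ge0.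
apply: is_derive_eq (is_derive_sqrt_comp D sq0) _.
rewrite -/(hyp _ _) -/x -/t -/s; field; exact/lt0r_neq0/hyp_gt0.
Qed.

(** This is the case b = 0 of the differential equation satisfied by the angles n_i. *)
Lemma is_derive_lag : is_derive p u (fun q => lag (X q) (T q))
  ((x * dt / (1 + t ^+ 2) - (x * dt - t * dx) / (s + 1)) / s).
Proof.
have s0 : 0 < s := hyp_gt0 x t.
have t0 : 0 < 1 + t ^+ 2 by rewrite ltr_pwDl// sqr_ge0.
have D0 : 1 + t ^+ 2 + s != 0 by rewrite gt_eqF// addr_gt0.
have D1 := is_derive_add (is_derive_add (is_derive_const p u 1) (is_derive_mul DT DT))
  is_derive_hyp.
apply: is_derive_eq (is_derive_atan (is_derive_div (is_derive_mul DX DT) D1 D0)) _.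
rewrite -[T p * T p]/(T p ^+ 2) -/x -/t -/s.
have -> : 1 + (x * t / (1 + t ^+ 2 + s)) ^+ 2 =
    (1 + t ^+ 2) * (s + 1) ^+ 2 / (1 + t ^+ 2 + s) ^+ 2.
  rewrite -lag_denom -/s; field; exact: D0.
apply/eqP; rewrite -subr_eq0; apply/eqP.
rewrite (_ : _ - _ = t * dx / (s * (1 + t ^+ 2) * (s + 1) ^+ 2) *
   (s ^+ 2 - (1 + x ^+ 2 + t ^+ 2))); last first.
  by field; rewrite ?D0 ?lt0r_neq0// addr_gt0.
by rewrite sqr_hyp subrr mulr0.
Qed.

End Along.

(** Rotation preserves s and moves (X, T) with velocity (-T, X), so the derivative collapses to (s +
    b X) / (1 + T^2), which is positive. *)
Lemma lag_rotation_incr b x t : -1 <= b <= 1 ->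
  {homo (fun th => th + (lag (x * cos th - t * sin th) (x * sin th + t * cos th)
     + b * atan (x * sin th + t * cos th))) : u v / u < v}.
Proof.
move=> hb; set f := (fun th => _); move=> u v uv.
pose X th := x * cos th - t * sin th; pose T th := x * sin th + t * cos th.
have DX (th : R) : is_derive th 1 X (- T th).
  apply: is_derive_eq (is_derive_sub (is_derive_mul (is_derive_const _ _ x) (is_derive_cos th))
    (is_derive_mul (is_derive_const _ _ t) (is_derive_sin th))) _.
  by rewrite /T; ring.
have DT (th : R) : is_derive th 1 T (X th).
  apply: is_derive_eq (is_derive_add (is_derive_mul (is_derive_const _ _ x) (is_derive_sin th))
    (is_derive_mul (is_derive_const _ _ t) (is_derive_cos th))) _.
  by rewrite /X; ring.
have Df (th : R) : is_derive th 1 f ((hyp (X th) (T th) + b * X th) / (1 + T th ^+ 2)).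
  apply: is_derive_eq (is_derive_add (is_derive_id _ _) (is_derive_add
    (is_derive_lag (DX th) (DT th)) (is_derive_mul (is_derive_const _ _ b)
    (is_derive_atan (DT th))))) _.
  have s0 := hyp_gt0 (X th) (T th); set s := hyp (X th) (T th) in s0 *.
  have t0 : 0 < 1 + T th ^+ 2 by rewrite ltr_pwDl// sqr_ge0.
  apply/eqP; rewrite -subr_eq0; apply/eqP.
  rewrite (_ : _ - _ = (s ^+ 2 - (1 + X th ^+ 2 + T th ^+ 2)) * (1 / (s * (s + 1)) - 1 / (s * (1 + T th ^+ 2)))); last first.
    by field; rewrite ?lt0r_neq0// addr_gt0.
  by rewrite sqr_hyp subrr mul0r.
have [|c _] := MVT uv (fun th _ => Df th).
  apply: continuous_subspaceT => th; apply: differentiable_continuous.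
  by apply/derivable1_diffP; have [] := Df th.
rewrite -subr_gt0 => ->; rewrite mulr_gt0 ?subr_gt0// divr_gt0//.
  exact: hyp_slope_gt0.
by rewrite ltr_pwDl// sqr_ge0.
Qed.

End Calculus.

(** * Algebraic identities behind the equality of the two pullbacks *)

Section Forms.
Variable R : realType.
Implicit Types x t s b m c : R.

(** The differentials are functions of a tangent vector (dx, dt); evaluating 2-forms on such a
    vector and a primed one turns identities of forms into field identities. *)
Definition dhyp x t dx dt : R := (x * dx + t * dt) / hyp x t.
Definition dlag x t dx dt : R :=
  (x * dt / (1 + t ^+ 2) - (x * dt - t * dx) / (hyp x t + 1)) / hyp x t.
Definition dtwist b x t dx dt : R := dlag x t dx dt + b * (dt / (1 + t ^+ 2)).

(* The contribution of one plane to the equality of the two pullbacks of omega. *)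
Lemma factor_form b x t m dx dt dm dx' dt' dm' :
  let s := hyp x t in
  let ds := dhyp x t dx dt in let ds' := dhyp x t dx' dt' in
  2 * m / (s + 1) * (dx * dt' - dt * dx')
  + ((dm / (s + 1) - m * ds / (s + 1) ^+ 2) * (x * dt' - t * dx')
     - (dm' / (s + 1) - m * ds' / (s + 1) ^+ 2) * (x * dt - t * dx))
  + ((dm * s + m * ds) * dtwist b x t dx' dt' - (dm' * s + m * ds') * dtwist b x t dx dt)
  = (m * (b * ds + dx) + dm * (b * s + x)) * (dt' / (1 + t ^+ 2))
    - (m * (b * ds' + dx') + dm' * (b * s + x)) * (dt / (1 + t ^+ 2)).
Proof.
move=> s ds ds'; have s0 : 0 < s := hyp_gt0 x t.
have t0 : 0 < 1 + t ^+ 2 by rewrite ltr_pwDl// sqr_ge0.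
apply/eqP; rewrite -subr_eq0; apply/eqP.
rewrite /ds /ds' /dtwist /dlag /dhyp -/s.
rewrite [LHS](_ : _ = m * (dx * dt' - dt * dx') * (s ^+ 2 - (1 + x ^+ 2 + t ^+ 2)) *
  (1 / (s * (s + 1) ^+ 2) - 1 / (s ^+ 2 * (1 + t ^+ 2)) + 1 / (s ^+ 2 * (s + 1)))).
  by rewrite sqr_hyp subrr mulr0 mul0r.
by field; rewrite ?lt0r_neq0// addr_gt0.
Qed.

(** The area form in the plane of k e^(i n) (x + i t), with c = cos n and e = sin n. The coefficient
    of dn on the right is the differential of k^2 (x^2 + t^2) / 2. *)
Lemma rotation_form x t k c e dx dt dk dn dx' dt' dk' dn' :
  (dk * (x * c - t * e) + k * (dx * c - x * (e * dn) - dt * e - t * (c * dn)))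
  * (dk' * (x * e + t * c) + k * (dx' * e + x * (c * dn') + dt' * c - t * (e * dn')))
  - (dk * (x * e + t * c) + k * (dx * e + x * (c * dn) + dt * c - t * (e * dn)))
  * (dk' * (x * c - t * e) + k * (dx' * c - x * (e * dn') - dt' * e - t * (c * dn')))
  = (c ^+ 2 + e ^+ 2) *
    (k ^+ 2 * (dx * dt' - dt * dx')
     + (k * dk * (x * dt' - t * dx') - k * dk' * (x * dt - t * dx))
     + ((k ^+ 2 * (x * dx + t * dt) + k * dk * (x ^+ 2 + t ^+ 2)) * dn'
        - (k ^+ 2 * (x * dx' + t * dt') + k * dk' * (x ^+ 2 + t ^+ 2)) * dn)).
Proof. ring. Qed.

(** Since x^2 + t^2 = s^2 - 1, the product of m / (s + 1) and x^2 + t^2 is m (s - 1); both sides are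
    its differential. *)
Lemma radial_form x t m dx dt dm :
  let s := hyp x t in let ds := dhyp x t dx dt in
  2 * (m / (s + 1)) * (x * dx + t * dt) +
    (dm / (s + 1) - m * ds / (s + 1) ^+ 2) * (x ^+ 2 + t ^+ 2) = dm * (s - 1) + m * ds.
Proof.
move=> s ds; have s0 : 0 < s := hyp_gt0 x t.
have -> : x ^+ 2 + t ^+ 2 = s ^+ 2 - 1 by rewrite sqr_hyp; ring.
rewrite /ds /dhyp -/s; field.
by rewrite !lt0r_neq0// addr_gt0.
Qed.

(** Used with f_i = d(m (s_i - 1)) and g_i = d(m s_i). As m (s1 + s2) = 1, g1 + g2 = 0 and f1 - f2 =
    2 g1; hence the opposite rotations by half of n1 - n2 decouple into one term per plane. *)
Lemma twisted_sum (f1 f2 g1 g2 n1 n2 f1' f2' g1' g2' n1' n2' : R) :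
  f1 - f2 = 2 * g1 -> g2 = - g1 -> f1' - f2' = 2 * g1' -> g2' = - g1' ->
  f1 * ((n1' - n2') / 2) - f1' * ((n1 - n2) / 2)
  + (f2 * - ((n1' - n2') / 2) - f2' * - ((n1 - n2) / 2))
  = (g1 * n1' - g1' * n1) + (g2 * n2' - g2' * n2).
Proof.
move=> h h2 h' h2'; rewrite h2 h2'.
rewrite (_ : f1 = f2 + 2 * g1); last by rewrite -h; ring.
rewrite (_ : f1' = f2' + 2 * g1'); last by rewrite -h'; ring.
by field.
Qed.

End Forms.

(** * The two charts and their parameters *)

Section Charts.
Variables (R : realType) (a a1 a2 : R).
Local Notation V := 'rV[R]_4.

Definition mk4 (x1 x2 y1 y2 : R) : V := \row_i [:: x1; x2; y1; y2]`_i.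

Lemma mk4E x1 x2 y1 y2 : (c4 (mk4 x1 x2 y1 y2) 0 = x1) * (c4 (mk4 x1 x2 y1 y2) 1 = x2) *
  (c4 (mk4 x1 x2 y1 y2) 2 = y1) * (c4 (mk4 x1 x2 y1 y2) 3 = y2).
Proof. by rewrite /c4 /mk4 !mxE !inordK. Qed.

Lemma ord4P (P : 'I_4 -> Prop) :
  P (inord 0) -> P (inord 1) -> P (inord 2) -> P (inord 3) -> forall i, P i.
Proof.
move=> P0 P1 P2 P3 [[|[|[|[|//]]]] hi].
- by rewrite (_ : Ordinal hi = inord 0)//; apply: val_inj; rewrite /= inordK.
- by rewrite (_ : Ordinal hi = inord 1)//; apply: val_inj; rewrite /= inordK.
- by rewrite (_ : Ordinal hi = inord 2)//; apply: val_inj; rewrite /= inordK.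
- by rewrite (_ : Ordinal hi = inord 3)//; apply: val_inj; rewrite /= inordK.
Qed.

Lemma c4_inj (z w : V) : (forall k, (k < 4)%N -> c4 z k = c4 w k) -> z = w.
Proof.
move=> h; apply/rowP; apply: ord4P; by [exact: (h 0%N)|exact: (h 1%N)|exact: (h 2%N)|exact: (h 3%N)].
Qed.

(* [_1] and [_2] refer to the two symplectic planes; a point of the chart is
   (x1, x2, t1, t2), listed like the coordinates (x1, x2, y1, y2) of R^4. *)
Definition s1 (p : V) := hyp (c4 p 0) (c4 p 2).
Definition s2 (p : V) := hyp (c4 p 1) (c4 p 3).
Definition b1 := 1 - 2 * a1 / a.
Definition b2 := 1 - 2 * a2 / a.
Definition twist (b x t : R) := lag x t + b * atan t.
Definition nu (p : V) := (twist b1 (c4 p 0) (c4 p 2) - twist b2 (c4 p 1) (c4 p 3)) / 2.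
Definition k1 (p : V) := Num.sqrt (a / (pi * ((s1 p + s2 p) * (s1 p + 1)))).
Definition k2 (p : V) := Num.sqrt (a / (pi * ((s1 p + s2 p) * (s2 p + 1)))).

Definition diamond_chart (p : V) : V :=
  mk4 (a1 + a / 2 * ((b1 * s1 p + c4 p 0) / (s1 p + s2 p)))
      (a2 + a / 2 * ((b2 * s2 p + c4 p 1) / (s1 p + s2 p)))
      (1 / 2 + atan (c4 p 2) / pi)
      (1 / 2 + atan (c4 p 3) / pi).

Definition ball_chart (p : V) : V :=
  mk4 (k1 p * (c4 p 0 * cos (nu p) - c4 p 2 * sin (nu p)))
      (k2 p * (c4 p 1 * cos (- nu p) - c4 p 3 * sin (- nu p)))
      (k1 p * (c4 p 0 * sin (nu p) + c4 p 2 * cos (nu p)))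
      (k2 p * (c4 p 1 * sin (- nu p) + c4 p 3 * cos (- nu p))).

Hypothesis a_gt0 : 0 < a.

Let spos p : (0 < s1 p) * (0 < s2 p) * (0 < s1 p + s2 p).
Proof. by rewrite addr_gt0 ?hyp_gt0. Qed.

Let kpos1 p : 0 < a / (pi * ((s1 p + s2 p) * (s1 p + 1))).
Proof. by rewrite divr_gt0// !mulr_gt0 ?pi_gt0 ?addr_gt0 ?spos. Qed.

Let kpos2 p : 0 < a / (pi * ((s1 p + s2 p) * (s2 p + 1))).
Proof. by rewrite divr_gt0// !mulr_gt0 ?pi_gt0 ?addr_gt0 ?spos. Qed.

(** * Smoothness of the two charts *)

Lemma smooth_rV_mk4 (U : set V) (f0 f1 f2 f3 : V -> R) :
  smooth U f0 -> smooth U f1 -> smooth U f2 -> smooth U f3 ->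
  smooth_rV U (fun p => mk4 (f0 p) (f1 p) (f2 p) (f3 p)).
Proof.
move=> h0 h1 h2 h3; apply: ord4P => k;
  [move: (h0 k)|move: (h1 k)|move: (h2 k)|move: (h3 k)];
  by congr (Ck _ _ _); apply/funext => p; rewrite mxE inordK.
Qed.

Lemma smooth_hyp k (f g : V -> R) : Ck k setT f -> Ck k setT g -> Ck k setT (fun p => hyp (f p) (g p)).
Proof.
move=> cf cg; apply: (Ck_sqrt openT) => [p _|].
  by rewrite -addrA ltr_pwDl// addr_ge0// sqr_ge0.
by do 2![apply: (CkD openT); [|exact: (CkM openT)]]; apply: (Ck_cst openT).
Qed.

Lemma smooth_twist k b (f g : V -> R) :
  Ck k setT f -> Ck k setT g -> Ck k setT (fun p => twist b (f p) (g p)).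
Proof.
move=> cf cg; apply: (CkD openT).
  apply: (Ck_atan openT); apply: (CkM openT); first exact: (CkM openT).
  apply: (CkV openT) => [p _|].
    by rewrite gt_eqF// addr_gt0 ?hyp_gt0// ltr_pwDl// sqr_ge0.
  apply: (CkD openT); last exact: smooth_hyp.
  by apply: (CkD openT); [exact: (Ck_cst openT)|exact: (CkM openT)].
by apply: (CkM openT); [exact: (Ck_cst openT)|exact: (Ck_atan openT)].
Qed.

Let cc k j : Ck k setT (fun p : V => c4 p j).
Proof. exact: (Ck_coord k (inord j) openT). Qed.

Let cs k : Ck k setT s1 * Ck k setT s2.
Proof. by split; exact: smooth_hyp. Qed.

Let cS k : Ck k setT (fun p => (s1 p + s2 p)).
Proof. by apply: (CkD openT); [exact: (cs k).1|exact: (cs k).2]. Qed.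

Let cnu k : Ck k setT nu.
Proof.
apply: (CkM openT); last exact: (Ck_cst openT).
by apply: (CkB openT); exact: smooth_twist.
Qed.

Lemma smooth_diamond_chart : smooth_rV setT diamond_chart.
Proof.
have cX b j s : (forall k, Ck k setT s) ->
    smooth setT (fun p => a / 2 * ((b * s p + c4 p j) / (s1 p + s2 p))).
  move=> css k; apply: (CkM openT); first exact: (Ck_cst openT).
  apply: (CkM openT); last by apply: (CkV openT) => // p _; rewrite gt_eqF ?spos.
  by apply: (CkD openT) => //; apply: (CkM openT) => //; exact: (Ck_cst openT).
apply: smooth_rV_mk4 => k; apply: (CkD openT); try exact: (Ck_cst openT).
- by apply: cX => i; exact: (cs i).1.
- by apply: cX => i; exact: (cs i).2.
- by apply: (CkM openT); [exact: (Ck_atan openT)|exact: (Ck_cst openT)].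
- by apply: (CkM openT); [exact: (Ck_atan openT)|exact: (Ck_cst openT)].
Qed.

Lemma smooth_ball_chart : smooth_rV setT ball_chart.
Proof.
have ck s : (forall k, Ck k setT s) -> (forall p, 0 < s p) ->
    smooth setT (fun p => Num.sqrt (a / (pi * ((s1 p + s2 p) * (s p + 1))))).
  move=> css s0 k; have P p : 0 < pi * ((s1 p + s2 p) * (s p + 1)).
    by rewrite !mulr_gt0 ?pi_gt0 ?addr_gt0 ?spos.
  apply: (Ck_sqrt openT) => [p _|]; first exact: divr_gt0.
  apply: (CkM openT); first exact: (Ck_cst openT).
  apply: (CkV openT) => [p _|]; first by rewrite gt_eqF.
  apply: (CkM openT); first exact: (Ck_cst openT).
  apply: (CkM openT) => //; apply: (CkD openT) => //; exact: (Ck_cst openT).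
have ck1 : smooth setT k1 by apply: ck => [k|p]; [exact: (cs k).1|rewrite spos].
have ck2 : smooth setT k2 by apply: ck => [k|p]; [exact: (cs k).2|rewrite spos].
apply: smooth_rV_mk4 => k; (apply: (CkM openT); [by [exact: ck1|exact: ck2]|]);
  apply: (CkD openT); try apply: (CkN openT); apply: (CkM openT) => //;
  by [exact: (Ck_sin_cos openT (cnu k)).1|exact: (Ck_sin_cos openT (cnu k)).2
    |exact: (Ck_sin_cos openT (CkN openT (cnu k))).1|exact: (Ck_sin_cos openT (CkN openT (cnu k))).2].
Qed.

Lemma is_derive_c4 (p u : V) j : is_derive p u (fun q : V => c4 q j) (c4 u j).
Proof.
have @f : {linear V -> R}.
  by exists (fun N : V => N 0 (inord j)); do 2![eexists]; do ?[constructor];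
     rewrite ?mxE// => ? *; rewrite ?mxE//; move=> ?; rewrite !mxE.
rewrite (_ : (fun _ => _) = f)//.
have df : differentiable f p by exact/linear_differentiable/coord_continuous.
split; first exact: diff_derivable.
by rewrite deriveE// diff_lin//; exact: coord_continuous.
Qed.

Lemma is_derive_twist b (W : normedModType R) (p u : W) (X T : W -> R) dx dt :
  is_derive p u X dx -> is_derive p u T dt ->
  is_derive p u (fun q => twist b (X q) (T q)) (dtwist b (X p) (T p) dx dt).
Proof.
move=> DX DT; apply: is_derive_eq (is_derive_add (is_derive_lag DX DT)
  (is_derive_mul (is_derive_const p u b) (is_derive_atan DT))) _.
by rewrite mulr0 addr0.
Qed.

Lemma derive_mk4 (f0 f1 f2 f3 : V -> R) (p u : V) d0 d1 d2 d3 :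
  differentiable (fun q => mk4 (f0 q) (f1 q) (f2 q) (f3 q)) p ->
  is_derive p u f0 d0 -> is_derive p u f1 d1 -> is_derive p u f2 d2 -> is_derive p u f3 d3 ->
  'D_u (fun q => mk4 (f0 q) (f1 q) (f2 q) (f3 q)) p = mk4 d0 d1 d2 d3.
Proof.
move=> dF [_ <-] [_ <-] [_ <-] [_ <-]; apply/rowP; apply: ord4P; rewrite derive_rV// mxE inordK//=;
  by congr (derive _ _ _); apply/funext => q; rewrite mxE inordK.
Qed.

(** * Explicit derivatives of the two charts *)

Section Derivatives.
Variables p u : V.
Local Notation x1 := (c4 p 0).
Local Notation x2 := (c4 p 1).
Local Notation t1 := (c4 p 2).
Local Notation t2 := (c4 p 3).

Definition ds1 := dhyp x1 t1 (c4 u 0) (c4 u 2).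
Definition ds2 := dhyp x2 t2 (c4 u 1) (c4 u 3).
Definition dnu := (dtwist b1 x1 t1 (c4 u 0) (c4 u 2) - dtwist b2 x2 t2 (c4 u 1) (c4 u 3)) / 2.
(** The differential of m = 1 / (s1 + s2). The next two come from differentiating k_i^2 = (a / pi) m
    / (s_i + 1). *)
Definition dm := - (ds1 + ds2) / (s1 p + s2 p) ^+ 2.
Definition dk1 := a / pi * (dm / (s1 p + 1) - (s1 p + s2 p)^-1 * ds1 / (s1 p + 1) ^+ 2) / (2 * k1 p).
Definition dk2 := a / pi * (dm / (s2 p + 1) - (s1 p + s2 p)^-1 * ds2 / (s2 p + 1) ^+ 2) / (2 * k2 p).

Let Ds1 : is_derive p u s1 ds1. Proof. by apply: is_derive_hyp; exact: is_derive_c4. Qed.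
Let Ds2 : is_derive p u s2 ds2. Proof. by apply: is_derive_hyp; exact: is_derive_c4. Qed.

Let Dnu : is_derive p u nu dnu.
Proof.
apply: is_derive_eq (is_derive_mul (is_derive_sub
  (is_derive_twist b1 (is_derive_c4 p u 0) (is_derive_c4 p u 2))
  (is_derive_twist b2 (is_derive_c4 p u 1) (is_derive_c4 p u 3)))
  (is_derive_const p u 2^-1)) _.
by rewrite mulr0 add0r mulrC.
Qed.

Let Dk (s : V -> R) (ds : R) (Ds : is_derive p u s ds) : 0 < s p ->
  is_derive p u (fun q => Num.sqrt (a / (pi * ((s1 q + s2 q) * (s q + 1)))))
  (a / pi * (dm / (s p + 1) - (s1 p + s2 p)^-1 * ds / (s p + 1) ^+ 2) /
    (2 * Num.sqrt (a / (pi * ((s1 p + s2 p) * (s p + 1)))))).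
Proof.
move=> sp0; have S0 := (spos p).2; have sp1 : 0 < s p + 1 by exact: addr_gt0.
have P0 : 0 < pi * ((s1 p + s2 p) * (s p + 1)) by rewrite !mulr_gt0 ?pi_gt0.
have D := is_derive_mul (is_derive_const p u pi) (is_derive_mul (is_derive_add Ds1 Ds2)
  (is_derive_add Ds (is_derive_const p u 1))).
have mu0 : 0 < a / (pi * ((s1 p + s2 p) * (s p + 1))) by exact: divr_gt0.
apply: is_derive_eq (is_derive_sqrt_comp (is_derive_div (is_derive_const p u a) D (lt0r_neq0 P0)) mu0) _.
congr (_ / _); rewrite /dm; move: (pi) (pi_gt0 R) => c c0; field.
by rewrite !lt0r_neq0.
Qed.

Let Dk1 : is_derive p u k1 dk1. Proof. by apply: Dk; rewrite ?spos. Qed.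
Let Dk2 : is_derive p u k2 dk2. Proof. by apply: Dk; rewrite ?spos. Qed.

(** The terms are arranged to match the left side of [rotation_form], with angle - nu in the second
    plane. *)
Lemma derive_ball_chart : 'D_u ball_chart p =
  let c := cos (nu p) in let e := sin (nu p) in
  let c' := cos (- nu p) in let e' := sin (- nu p) in
  mk4 (dk1 * (x1 * c - t1 * e) + k1 p *
         (c4 u 0 * c - x1 * (e * dnu) - c4 u 2 * e - t1 * (c * dnu)))
      (dk2 * (x2 * c' - t2 * e') + k2 p *
         (c4 u 1 * c' - x2 * (e' * - dnu) - c4 u 3 * e' - t2 * (c' * - dnu)))
      (dk1 * (x1 * e + t1 * c) + k1 p *
         (c4 u 0 * e + x1 * (c * dnu) + c4 u 2 * c - t1 * (e * dnu)))
      (dk2 * (x2 * e' + t2 * c') + k2 p *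
         (c4 u 1 * e' + x2 * (c' * - dnu) + c4 u 3 * c' - t2 * (e' * - dnu))).
Proof.
have DN : is_derive p u (fun q => - nu q) (- dnu) by exact: is_deriveN.
have dF : differentiable ball_chart p by exact: smooth_rV_differentiable smooth_ball_chart _.
apply: derive_mk4 => //.
- apply: is_derive_eq (is_derive_mul Dk1 (is_derive_sub
    (is_derive_mul (is_derive_c4 p u 0) (is_derive_cos_comp Dnu))
    (is_derive_mul (is_derive_c4 p u 2) (is_derive_sin_comp Dnu)))) _; ring.
- apply: is_derive_eq (is_derive_mul Dk2 (is_derive_sub
    (is_derive_mul (is_derive_c4 p u 1) (is_derive_cos_comp DN))
    (is_derive_mul (is_derive_c4 p u 3) (is_derive_sin_comp DN)))) _; ring.
- apply: is_derive_eq (is_derive_mul Dk1 (is_derive_add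
    (is_derive_mul (is_derive_c4 p u 0) (is_derive_sin_comp Dnu))
    (is_derive_mul (is_derive_c4 p u 2) (is_derive_cos_comp Dnu)))) _; ring.
- apply: is_derive_eq (is_derive_mul Dk2 (is_derive_add
    (is_derive_mul (is_derive_c4 p u 1) (is_derive_sin_comp DN))
    (is_derive_mul (is_derive_c4 p u 3) (is_derive_cos_comp DN)))) _; ring.
Qed.

Lemma derive_diamond_chart : 'D_u diamond_chart p =
  let m := (s1 p + s2 p)^-1 in
  mk4 (a / 2 * (m * (b1 * ds1 + c4 u 0) + dm * (b1 * s1 p + x1)))
      (a / 2 * (m * (b2 * ds2 + c4 u 1) + dm * (b2 * s2 p + x2)))
      (c4 u 2 / (1 + t1 ^+ 2) / pi)
      (c4 u 3 / (1 + t2 ^+ 2) / pi).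
Proof.
have dF : differentiable diamond_chart p by exact: smooth_rV_differentiable smooth_diamond_chart _.
have S0 := lt0r_neq0 (spos p).2.
apply: derive_mk4 => //.
- apply: is_derive_eq (is_derive_add (is_derive_const p u a1) (is_derive_mul (is_derive_const p u (a / 2))
    (is_derive_div (is_derive_add (is_derive_mul (is_derive_const p u b1) Ds1) (is_derive_c4 p u 0))
      (is_derive_add Ds1 Ds2) S0))) _; rewrite /dm; field; exact: S0.
- apply: is_derive_eq (is_derive_add (is_derive_const p u a2) (is_derive_mul (is_derive_const p u (a / 2))
    (is_derive_div (is_derive_add (is_derive_mul (is_derive_const p u b2) Ds2) (is_derive_c4 p u 1))
      (is_derive_add Ds1 Ds2) S0))) _; rewrite /dm; field; exact: S0.
- apply: is_derive_eq (is_derive_add (is_derive_const p u (1 / 2))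
    (is_derive_mul (is_derive_atan (is_derive_c4 p u 2)) (is_derive_const p u pi^-1))) _; ring.
- apply: is_derive_eq (is_derive_add (is_derive_const p u (1 / 2))
    (is_derive_mul (is_derive_atan (is_derive_c4 p u 3)) (is_derive_const p u pi^-1))) _; ring.
Qed.

End Derivatives.

(** * Equality of the two pullbacks of omega *)

Lemma omega_mk4 x1 x2 y1 y2 x1' x2' y1' y2' :
  omega (mk4 x1 x2 y1 y2) (mk4 x1' x2' y1' y2') =
  (x1 * y1' - y1 * x1') + (x2 * y2' - y2 * x2').
Proof. by rewrite /omega !mk4E addrA. Qed.

(** [rotation_form] expands each plane of the ball, [radial_form] identifies the coefficient of d
    nu, [twisted_sum] separates the planes, and [factor_form] rewrites each plane as its diamond
    counterpart. *)
Lemma omega_charts p u w :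
  omega ('D_u ball_chart p) ('D_w ball_chart p) =
  omega ('D_u diamond_chart p) ('D_w diamond_chart p).
Proof.
have S0 := lt0r_neq0 (spos p).2; have pi0 : pi != 0 :> R by rewrite gt_eqF ?pi_gt0.
(* The factor a / (2 pi) is isolated because the diamond side has it too: a / 2 from X_i and 1 / pi
   from Y_i. *)
have ksq s : 0 < s -> Num.sqrt (a / (pi * ((s1 p + s2 p) * (s + 1)))) ^+ 2 =
    a / (2 * pi) * (2 * ((s1 p + s2 p)^-1 / (s + 1))).
  move=> s0; rewrite sqr_sqrtr; last by rewrite ltW// divr_gt0// !mulr_gt0 ?pi_gt0 ?addr_gt0 ?spos.
  by move: (pi) pi0 => c c0; field; rewrite S0 c0 lt0r_neq0// addr_gt0.
have kdk k d : 0 < k -> k * (a / pi * d / (2 * k)) = a / (2 * pi) * d.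
  by move=> k0; move: (pi) pi0 => c c0; field; rewrite c0 lt0r_neq0.
have k1k : k1 p ^+ 2 = a / (2 * pi) * (2 * ((s1 p + s2 p)^-1 / (s1 p + 1))) by rewrite ksq ?spos.
have k2k : k2 p ^+ 2 = a / (2 * pi) * (2 * ((s1 p + s2 p)^-1 / (s2 p + 1))) by rewrite ksq ?spos.
rewrite !derive_ball_chart !derive_diamond_chart !omega_mk4 !rotation_form !cos2Dsin2 !mul1r.
rewrite k1k k2k /dk1 /dk2 !kdk ?sqrtr_gt0 ?kpos1 ?kpos2//.
set m := (s1 p + s2 p)^-1; set A := a / (2 * pi).
have R1 v := radial_form (c4 p 0) (c4 p 2) m (c4 v 0) (c4 v 2) (dm p v).
have R2 v := radial_form (c4 p 1) (c4 p 3) m (c4 v 1) (c4 v 3) (dm p v).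
move: R1 R2; rewrite /= -!/(s1 _) -!/(s2 _) => R1 R2.
have E (c r e q f : R) : c * r + e * q = f -> A * c * r + A * e * q = A * f.
  by move=> <-; rewrite mulrDr !mulrA.
rewrite !(E _ _ _ _ _ (R1 _)) !(E _ _ _ _ _ (R2 _)).
(* These are the hypotheses of [twisted_sum], consequences of m (s1 + s2) = 1. *)
have T v : (dm p v * (s1 p - 1) + m * ds1 p v) - (dm p v * (s2 p - 1) + m * ds2 p v) =
    2 * (dm p v * s1 p + m * ds1 p v) /\
  dm p v * s2 p + m * ds2 p v = - (dm p v * s1 p + m * ds1 p v).
  by split; rewrite /dm /m; field; exact: S0.
have := twisted_sum (dtwist b1 (c4 p 0) (c4 p 2) (c4 u 0) (c4 u 2))
  (dtwist b2 (c4 p 1) (c4 p 3) (c4 u 1) (c4 u 3)) (dtwist b1 (c4 p 0) (c4 p 2) (c4 w 0) (c4 w 2))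
  (dtwist b2 (c4 p 1) (c4 p 3) (c4 w 1) (c4 w 3)) (T u).1 (T u).2 (T w).1 (T w).2.
rewrite -!/(dnu _ _) => TS.
have F1 := factor_form b1 (c4 p 0) (c4 p 2) m (c4 u 0) (c4 u 2) (dm p u) (c4 w 0) (c4 w 2) (dm p w).
have F2 := factor_form b2 (c4 p 1) (c4 p 3) m (c4 u 1) (c4 u 3) (dm p u) (c4 w 1) (c4 w 3) (dm p w).
move: F1 F2; rewrite /= -!/(s1 _) -!/(s2 _) -!/(ds1 _ _) -!/(ds2 _ _) => F1 F2.
have F := congr1 ( *%R A) (congr2 +%R F1 F2).
move/eqP: TS; rewrite -subr_eq0 => /eqP/(congr1 ( *%R A)); rewrite mulr0 => TS.
have t0 (t : R) : 1 + t ^+ 2 != 0 by rewrite gt_eqF// ltr_pwDl// sqr_ge0.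
apply: (eq_trans _ (eq_trans F _)); last first.
  by rewrite /A; move: (pi) pi0 => c c0; field; rewrite c0 !t0.
by apply/eqP; rewrite -subr_eq0; apply/eqP; apply: (eq_trans _ TS); ring.
Qed.
End Charts.

(** * Both charts are immersions *)

Section Rank.
Variable R : realType.

(** Solving each plane gives e_i = D s_i - D r_i with r_i = (s_i^2 - x_i^2) / (s_i + b_i x_i) > 0.
    The equation for e1 + e2 then forces D (r1 + r2) = 0, so D = 0. *)
Lemma dilation_rank (b1 b2 x1 x2 s1 s2 d1 d2 e1 e2 D : R) :
  0 < s1 -> 0 < s2 -> x1 ^+ 2 < s1 ^+ 2 -> x2 ^+ 2 < s2 ^+ 2 ->
  0 < s1 + b1 * x1 -> 0 < s2 + b2 * x2 ->
  e1 * s1 = x1 * d1 -> e2 * s2 = x2 * d2 ->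
  b1 * e1 + d1 = D * (b1 * s1 + x1) -> b2 * e2 + d2 = D * (b2 * s2 + x2) ->
  e1 + e2 = D * (s1 + s2) -> d1 = 0 /\ d2 = 0.
Proof.
have solve b x s d e : 0 < s -> 0 < s + b * x -> e * s = x * d -> b * e + d = D * (b * s + x) ->
    d = D * ((b * s + x) * s / (s + b * x)) /\
    e = D * s - D * ((s ^+ 2 - x ^+ 2) / (s + b * x)).
  move=> sp qp es bd; have [s0 q0] := (lt0r_neq0 sp, lt0r_neq0 qp).
  have dE : d = D * ((b * s + x) * s / (s + b * x)).
    apply: (mulIf q0); rewrite -!mulrA mulVf// mulr1 [RHS]mulrA -bd.
    rewrite (_ : d * (s + b * x) = d * s + b * (x * d)); last ring.
    by rewrite -es; ring.
  split=> //; apply: (mulIf s0); rewrite es dE; field; exact: q0.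
move=> sp1 sp2 xs1 xs2 q1 q2 es1 es2 bd1 bd2 ee.
have [dE1 eE1] := solve _ _ _ _ _ sp1 q1 es1 bd1.
have [dE2 eE2] := solve _ _ _ _ _ sp2 q2 es2 bd2.
have r1 : 0 < (s1 ^+ 2 - x1 ^+ 2) / (s1 + b1 * x1) by rewrite divr_gt0// subr_gt0.
have r2 : 0 < (s2 ^+ 2 - x2 ^+ 2) / (s2 + b2 * x2) by rewrite divr_gt0// subr_gt0.
have : D * ((s1 ^+ 2 - x1 ^+ 2) / (s1 + b1 * x1) + (s2 ^+ 2 - x2 ^+ 2) / (s2 + b2 * x2)) = 0.
  move: ee; rewrite eE1 eE2; set r := _ / _; set r' := _ / _ => ee.
  by move/eqP: ee; rewrite -subr_eq0 => /eqP ee; apply/oppr_inj; rewrite oppr0 -ee; ring.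
move/eqP; rewrite mulf_eq0 (gt_eqF (addr_gt0 r1 r2)) orbF => /eqP D0.
by rewrite dE1 dE2 D0 !mul0r.
Qed.

Variables (a a1 a2 : R).
Hypotheses (a_gt0 : 0 < a) (a1P : 0 <= a1 <= a) (a2P : 0 <= a2 <= a).
Local Notation V := 'rV[R]_4.
Local Notation FU := (diamond_chart a a1 a2).
Local Notation FB := (ball_chart a a1 a2).

Lemma slope_bounds c : 0 <= c <= a -> -1 <= 1 - 2 * c / a <= 1.
Proof.
move=> /andP[c0 ca]; have h0 : 0 <= c / a by rewrite divr_ge0// ltW.
have h1 : c / a <= 1 by rewrite ler_pdivrMr// mul1r.
by rewrite -mulrA; lra.
Qed.

(** The last two coordinates force dt_i = 0; for the other two, [dilation_rank] applies. *)
Lemma diamond_chart_immersion p u : 'D_u FU p = 0 -> u = 0.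
Proof.
rewrite derive_diamond_chart; set m := _^-1.
have pi0 : pi != 0 :> R by rewrite gt_eqF ?pi_gt0.
have t0 (t : R) : 1 + t ^+ 2 != 0 by rewrite gt_eqF// ltr_pwDl// sqr_ge0.
move=> /(congr1 (@c4 R)) E.
have Z k : @c4 R 0 k = 0 by rewrite /c4 mxE.
have dt1 : c4 u 2 = 0.
  by have /eqP := congr1 (@^~ 2%N) E; rewrite mk4E Z !mulf_eq0 !invr_eq0 (negPf pi0) (negPf (t0 _)) !orbF => /eqP.
have dt2 : c4 u 3 = 0.
  by have /eqP := congr1 (@^~ 3%N) E; rewrite mk4E Z !mulf_eq0 !invr_eq0 (negPf pi0) (negPf (t0 _)) !orbF => /eqP.
have h0 : s1 p + s2 p != 0 by rewrite gt_eqF// addr_gt0 ?hyp_gt0.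
have a20 : a / 2 != 0 by rewrite gt_eqF// divr_gt0.
(* The logarithmic derivative of s1 + s2, so that dm = - D m. *)
pose D := (ds1 p u + ds2 p u) / (s1 p + s2 p).
have dmE : dm p u = - D * m by rewrite /dm /D /m; field.
have lin b e d s x : a / 2 * (m * (b * e + d) + dm p u * (b * s + x)) = 0 ->
    b * e + d = D * (b * s + x).
  move/eqP; rewrite mulf_eq0 (negPf a20) /= dmE.
  rewrite (_ : _ + _ = m * (b * e + d - D * (b * s + x))); last ring.
  by rewrite mulf_eq0 invr_eq0 (negPf h0) subr_eq0 => /eqP.
have [dx1 dx2] : c4 u 0 = 0 /\ c4 u 1 = 0.
  have sq x t : x ^+ 2 < hyp x t ^+ 2 :> R.
    by rewrite sqr_hyp addrAC ltrDr ltr_pwDl// sqr_ge0.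
  apply: (@dilation_rank (b1 a a1) (b2 a a2) (c4 p 0) (c4 p 1) (s1 p) (s2 p) _ _ (ds1 p u) (ds2 p u) D);
    rewrite ?hyp_gt0 ?sq ?hyp_slope_gt0 ?slope_bounds//.
  - by rewrite /ds1 /dhyp dt1 mulr0 addr0 divfK// gt_eqF// hyp_gt0.
  - by rewrite /ds2 /dhyp dt2 mulr0 addr0 divfK// gt_eqF// hyp_gt0.
  - by apply: lin; have := congr1 (@^~ 0%N) E; rewrite mk4E Z.
  - by apply: lin; have := congr1 (@^~ 1%N) E; rewrite mk4E Z.
  - by rewrite /D divfK.
by apply: c4_inj => [] [|[|[|[|//]]]] _; rewrite Z.
Qed.

(* omega is nondegenerate and pulls back to the same form under the two charts. *)
Lemma ball_chart_immersion p u : 'D_u FB p = 0 -> u = 0.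
Proof.
have dU : differentiable FU p by exact: smooth_rV_differentiable (@smooth_diamond_chart _ a a1 a2) _.
move=> FB0; apply: (@diamond_chart_immersion p).
have J := jacobian_unit dU (@diamond_chart_immersion p).
have om w : omega ('D_u FU p) w = 0.
  have -> : w = 'D_(w *m invmx ('J FU p)) FU p by rewrite deriveEjacobian// mulmxKV.
  by rewrite -(omega_charts a1 a2 a_gt0) FB0 /omega /c4 !mxE; ring.
apply: c4_inj => k hk; have Z j : @c4 R 0 j = 0 by rewrite /c4 mxE.
rewrite Z; move: k hk => [|[|[|[|//]]]] _.
- by have := om (mk4 0 0 1 0); rewrite /omega !mk4E => <-; ring.
- by have := om (mk4 0 0 0 1); rewrite /omega !mk4E => <-; ring.
- by apply: oppr_inj; have := om (mk4 1 0 0 0); rewrite /omega !mk4E oppr0 => <-; ring.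
- by apply: oppr_inj; have := om (mk4 0 1 0 0); rewrite /omega !mk4E oppr0 => <-; ring.
Qed.

End Rank.

(** * The ball chart is a bijection onto the ball with locally bounded inverse *)

Section BallChart.
Variables (R : realType) (a a1 a2 : R).
Hypotheses (a_gt0 : 0 < a) (a1P : 0 <= a1 <= a) (a2P : 0 <= a2 <= a).
Local Notation V := 'rV[R]_4.
Local Notation FB := (ball_chart a a1 a2).

Definition rotx (x t th : R) := x * cos th - t * sin th.
Definition roty (x t th : R) := x * sin th + t * cos th.

Lemma rot_rot x t u v : rotx (rotx x t u) (roty x t u) v = rotx x t (u + v) /\
  roty (rotx x t u) (roty x t u) v = roty x t (u + v).
Proof. by rewrite /rotx /roty cosD sinD; split; ring. Qed.

Lemma rot0 x t : rotx x t 0 = x /\ roty x t 0 = t.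
Proof. by rewrite /rotx /roty cos0 sin0; split; ring. Qed.

Lemma rot_norm x t th : rotx x t th ^+ 2 + roty x t th ^+ 2 = x ^+ 2 + t ^+ 2.
Proof.
rewrite (_ : _ + _ = (x ^+ 2 + t ^+ 2) * (cos th ^+ 2 + sin th ^+ 2)).
  by rewrite cos2Dsin2 mulr1.
by rewrite /rotx /roty; ring.
Qed.

Lemma hyp_rot x t th : hyp (rotx x t th) (roty x t th) = hyp x t.
Proof. by rewrite /hyp -!addrA rot_norm. Qed.

Lemma sum4 (f : nat -> R) : \sum_(i < 4) f i = f 0%N + f 1%N + f 2%N + f 3%N.
Proof. by rewrite !big_ord_recr big_ord0 /= add0r. Qed.

Lemma sum_sqr_c4 (z : V) : \sum_(i < 4) z ord0 i ^+ 2 =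
  (c4 z 0 ^+ 2 + c4 z 2 ^+ 2) + (c4 z 1 ^+ 2 + c4 z 3 ^+ 2).
Proof.
rewrite (eq_bigr (fun i : 'I_4 => c4 z i ^+ 2)) => [|i _]; last by rewrite /c4 inord_val.
by rewrite (sum4 (fun i => c4 z i ^+ 2)); ring.
Qed.

(** Each coordinate is smaller than its own s_i in absolute value. Preimages are therefore bounded
    by bounding s1 + s2. *)
Lemma norm_chart (p : V) : `|p| <= s1 p + s2 p.
Proof.
have s10 : 0 < s1 p := hyp_gt0 _ _; have s20 : 0 < s2 p := hyp_gt0 _ _.
have t_lt (x t : R) : `|t| < hyp x t by rewrite /hyp addrAC -/(hyp t x) ltr_norm_hyp.
rewrite /Num.norm /= mx_normrE; apply: bigmax_le => [|[i j] _ /=].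
  by rewrite ltW// addr_gt0.
rewrite (ord1 i); move: j; apply: ord4P; rewrite -/(c4 p _).
- by rewrite (le_trans (ltW (ltr_norm_hyp _ (c4 p 2))))// lerDl ltW.
- by rewrite (le_trans (ltW (ltr_norm_hyp _ (c4 p 3))))// lerDr ltW.
- by rewrite (le_trans (ltW (t_lt (c4 p 0) _)))// lerDl ltW.
- by rewrite (le_trans (ltW (t_lt (c4 p 1) _)))// lerDr ltW.
Qed.

(** The rotation drops out, leaving k_i^2 (x_i^2 + t_i^2) = k_i^2 (s_i^2 - 1), where s_i + 1
    cancels. *)
Lemma radii (p : V) :
  pi * (c4 (FB p) 0 ^+ 2 + c4 (FB p) 2 ^+ 2) = a * (s1 p - 1) / (s1 p + s2 p) /\
  pi * (c4 (FB p) 1 ^+ 2 + c4 (FB p) 3 ^+ 2) = a * (s2 p - 1) / (s1 p + s2 p).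
Proof.
have s10 : 0 < s1 p := hyp_gt0 _ _; have s20 : 0 < s2 p := hyp_gt0 _ _.
have S0 := addr_gt0 s10 s20; have pi0 : 0 < pi :> R := pi_gt0 R.
have aux x t th k : k = Num.sqrt (a / (pi * ((s1 p + s2 p) * (hyp x t + 1)))) ->
  pi * ((k * rotx x t th) ^+ 2 + (k * roty x t th) ^+ 2) = a * (hyp x t - 1) / (s1 p + s2 p).
  move=> ->; have h1 : 0 < hyp x t + 1 by rewrite addr_gt0 ?hyp_gt0.
  rewrite !exprMn -mulrDr rot_norm sqr_sqrtr; last by rewrite ltW// divr_gt0// !mulr_gt0.
  have -> : x ^+ 2 + t ^+ 2 = hyp x t ^+ 2 - 1 by rewrite sqr_hyp; ring.
  by move: (pi) pi0 => c c0; field; rewrite !lt0r_neq0.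
by split; rewrite !mk4E; exact: aux.
Qed.

Lemma ball_chart_in p : ball4 a (FB p).
Proof.
have s10 : 0 < s1 p := hyp_gt0 _ _; have s20 : 0 < s2 p := hyp_gt0 _ _.
have S0 := addr_gt0 s10 s20; have [r1 r2] := radii p.
suff : pi * \sum_(i < 4) FB p ord0 i ^+ 2 < a by [].
rewrite sum_sqr_c4 (mulrDr pi) r1 r2 -mulrDl ltr_pdivrMr// -mulrDr ltr_pM2l//; lra.
Qed.

(** Adding the two radii shows that the image determines s1 + s2, which grows without bound only
    towards the boundary sphere. *)
Lemma ball_chart_size p :
  (s1 p + s2 p) * (a - pi * \sum_(i < 4) FB p ord0 i ^+ 2) = 2 * a.
Proof.
have s10 : 0 < s1 p := hyp_gt0 _ _; have s20 : 0 < s2 p := hyp_gt0 _ _.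
have S0 := lt0r_neq0 (addr_gt0 s10 s20); have [r1 r2] := radii p.
by rewrite sum_sqr_c4 (mulrDr pi) r1 r2; field; exact: S0.
Qed.

(* Two points of the ball chart with the same image differ by opposite
   rotations of the two planes; the twist cannot compensate a nonzero rotation. *)
Lemma nu_rot p q w :
  c4 q 0 = rotx (c4 p 0) (c4 p 2) w -> c4 q 2 = roty (c4 p 0) (c4 p 2) w ->
  c4 q 1 = rotx (c4 p 1) (c4 p 3) (- w) -> c4 q 3 = roty (c4 p 1) (c4 p 3) (- w) ->
  0 < w -> nu a a1 a2 p - w < nu a a1 a2 q.
Proof.
move=> e0 e2 e1 e3 w0.
have := lag_rotation_incr (c4 p 0) (c4 p 2) (slope_bounds a_gt0 a1P) w0.
have w0' : - w < 0 by rewrite oppr_lt0.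
have := lag_rotation_incr (c4 p 1) (c4 p 3) (slope_bounds a_gt0 a2P) w0'.
rewrite /= -!/(rotx _ _ _) -!/(roty _ _ _) -e0 -e1 -e2 -e3.
rewrite !(proj1 (rot0 _ _)) !(proj2 (rot0 _ _)).
rewrite /nu /twist /b1 /b2.
set u1 := lag _ _ + _; set u2 := lag _ _ + _; set u3 := lag _ _ + _; set u4 := lag _ _ + _.
by lra.
Qed.

(** The image determines s1 + s2, then s1 and s2, then k1 and k2. What remains is a rotation by w =
    nu p - nu q, for which [nu_rot] would give nu q < nu q if w > 0. *)
Lemma ball_chart_inj : injective FB.
Proof.
move=> p q E.
have := ball_chart_size p; rewrite E -(ball_chart_size q).
have Ea : a - pi * \sum_(i < 4) FB q ord0 i ^+ 2 != 0.
  by rewrite gt_eqF// subr_gt0; exact: ball_chart_in.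
move=> /(mulIf Ea) ES.
have S0 : 0 < s1 q + s2 q by rewrite addr_gt0 ?hyp_gt0.
have [] := radii p; rewrite E ES; have [-> ->] := radii q.
have aux (u v : R) : a * (u - 1) / (s1 q + s2 q) = a * (v - 1) / (s1 q + s2 q) -> u = v.
  have Si : (s1 q + s2 q)^-1 != 0 by rewrite invr_eq0 gt_eqF.
  by move=> /(mulIf Si)/(mulfI (lt0r_neq0 a_gt0))/addIr.
move=> /aux E1 /aux E2.
have kk c : 0 < c -> Num.sqrt (a / (pi * ((s1 q + s2 q) * (c + 1)))) != 0.
  by move=> c0; rewrite gt_eqF// sqrtr_gt0 divr_gt0// !mulr_gt0 ?pi_gt0 ?addr_gt0 ?hyp_gt0.
have k10 : k1 a q != 0 by apply: kk; exact: hyp_gt0.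
have k20 : k2 a q != 0 by apply: kk; exact: hyp_gt0.
have kE1 : k1 a p = k1 a q by rewrite /k1 ES -E1.
have kE2 : k2 a p = k2 a q by rewrite /k2 ES -E2.
have C k := congr1 (fun z => c4 z k) E.
move: (C 0%N) (C 1%N) (C 2%N) (C 3%N); rewrite !mk4E kE1 kE2.
move=> /(mulfI k10) C0 /(mulfI k20) C1 /(mulfI k10) C2 /(mulfI k20) C3.
pose w := nu a a1 a2 p - nu a a1 a2 q.
have unrot x t x' t' u v : rotx x t u = rotx x' t' v -> roty x t u = roty x' t' v ->
    x' = rotx x t (u - v) /\ t' = roty x t (u - v).
  move=> h h'; have [<- <-] := rot_rot x t u (- v); rewrite h h'.
  by have [-> ->] := rot_rot x' t' v (- v); rewrite subrr; have [-> ->] := rot0 x' t'.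
have [e0 e2] := unrot _ _ _ _ _ _ C0 C2.
have [e1 e3] := unrot _ _ _ _ _ _ C1 C3.
have [e0' e2'] := unrot _ _ _ _ _ _ (esym C0) (esym C2).
have [e1' e3'] := unrot _ _ _ _ _ _ (esym C1) (esym C3).
have wE : nu a a1 a2 q - nu a a1 a2 p = - w by rewrite opprB.
have wE1 : - nu a a1 a2 p - - nu a a1 a2 q = - w by rewrite opprB opprK addrC.
have wE2 : - nu a a1 a2 q - - nu a a1 a2 p = - - w by rewrite !opprB opprK addrC.
rewrite -/w in e0 e2; rewrite wE in e0' e2'; rewrite wE1 in e1 e3; rewrite wE2 in e1' e3'.
(* A negative w is handled by exchanging p and q, whence the primed equations. *)
have w0 : w = 0.
  have [wn|wp|//] := ltgtP w 0.
    have wn' : 0 < - w by rewrite oppr_gt0.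
    by have := nu_rot e0' e2' e1' e3' wn'; rewrite /w; lra.
  by have := nu_rot e0 e2 e1 e3 wp; rewrite /w; lra.
rewrite w0 oppr0 in e0 e1 e2 e3.
apply: c4_inj => [] [|[|[|[|//]]]] _.
- by rewrite e0 (proj1 (rot0 _ _)).
- by rewrite e1 (proj1 (rot0 _ _)).
- by rewrite e2 (proj2 (rot0 _ _)).
- by rewrite e3 (proj2 (rot0 _ _)).
Qed.

(** Both arctangents are at most pi / 2 in absolute value and |b| <= 1; this fixes the interval on
    which the angle is sought. *)
Lemma twist_le (b x t : R) : -1 <= b <= 1 -> `|twist b x t| <= pi.
Proof.
rewrite -ler_norml => hb.
have at_le (y : R) : `|atan y| <= pi / 2.
  by rewrite ler_norml !ltW ?atan_gtNpi2 ?atan_ltpi2.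
apply: le_trans (ler_normD _ _) _; rewrite [pi]splitr; apply: lerD; first exact: at_le.
by rewrite normrM; apply: le_trans (at_le t); rewrite ler_piMl.
Qed.

(** The moduli of z prescribe s1 and s2, hence the point up to rotation in each plane; the angle is
    a zero of a continuous function. *)
Lemma ball_chart_surj z : ball4 a z -> exists p, FB p = z.
Proof.
move=> zB; have {}zB : pi * \sum_(i < 4) z ord0 i ^+ 2 < a by [].
pose r1 := c4 z 0 ^+ 2 + c4 z 2 ^+ 2; pose r2 := c4 z 1 ^+ 2 + c4 z 3 ^+ 2.
have pi0 : 0 < pi :> R := pi_gt0 R.
have r10 : 0 <= r1 by rewrite addr_ge0// sqr_ge0.
have r20 : 0 <= r2 by rewrite addr_ge0// sqr_ge0.
pose D := a - pi * (r1 + r2).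
have D0 : 0 < D by rewrite subr_gt0; rewrite sum_sqr_c4 in zB.
(* S, u1 and u2 are the values of s1 + s2, s1 and s2 dictated by [ball_chart_size] and [radii]. *)
pose S := 2 * a / D; have S0 : 0 < S by rewrite divr_gt0// mulr_gt0.
pose u1 := 1 + pi * r1 * S / a; pose u2 := 1 + pi * r2 * S / a.
have u1_ge1 : 1 <= u1 by rewrite lerDl; apply: (divr_ge0 _ (ltW a_gt0));
  apply: (mulr_ge0 _ (ltW S0)); apply: (mulr_ge0 (ltW pi0)).
have u2_ge1 : 1 <= u2 by rewrite lerDl; apply: (divr_ge0 _ (ltW a_gt0));
  apply: (mulr_ge0 _ (ltW S0)); apply: (mulr_ge0 (ltW pi0)).
have uS : u1 + u2 = S.
  rewrite /u1 /u2 /S /D; move: D0 pi0; rewrite /D; move: (pi) => c D0 c0; field.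
  by rewrite !lt0r_neq0.
have u1E : u1 = 1 + pi * r1 * S / a by [].
have u2E : u2 = 1 + pi * r2 * S / a by [].
clearbody u1 u2; clearbody S.
pose K u := Num.sqrt (a / (pi * (S * (u + 1)))).
have up1 (u : R) : 1 <= u -> 0 < u + 1 by lra.
have K0 u : 1 <= u -> 0 < K u.
  by move=> /up1 u0; rewrite sqrtr_gt0 divr_gt0// !mulr_gt0.
have KH x t r u : 1 <= u -> x ^+ 2 + t ^+ 2 = r -> u = 1 + pi * r * S / a -> hyp (x / K u) (t / K u) = u.
  move=> ug xr uE; have up := up1 _ ug.
  apply: hyp_uniq; first exact: lt_le_trans ug.
  rewrite -addrA !exprMn -mulrDl xr exprVn sqr_sqrtr; last by rewrite ltW// divr_gt0// !mulr_gt0.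
  have -> : r = (u - 1) * a / (pi * S).
    by rewrite uE; move: (pi) pi0 => c c0; field; rewrite !lt0r_neq0.
  by move: (pi) pi0 => c c0; field; rewrite !lt0r_neq0.
pose X1 := c4 z 0 / K u1; pose T1 := c4 z 2 / K u1.
pose X2 := c4 z 1 / K u2; pose T2 := c4 z 3 / K u2.
have H1 : hyp X1 T1 = u1 by exact: (KH _ _ r1).
have H2 : hyp X2 T2 = u2 by exact: (KH _ _ r2).
(* The twists after undoing the rotations by v and - v; a zero of h is an angle v equal to nu at the
   unrotated point. *)
pose n1 v := twist (b1 a a1) (rotx X1 T1 (- v)) (roty X1 T1 (- v)).
pose n2 v := twist (b2 a a2) (rotx X2 T2 v) (roty X2 T2 v).
pose h v := 2 * v - (n1 v - n2 v).
have n1_le v : `|n1 v| <= pi by apply: twist_le; exact: slope_bounds.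
have n2_le v : `|n2 v| <= pi by apply: twist_le; exact: slope_bounds.
have Dh v : derivable h v 1.
  have Dm : is_derive v 1 (fun v : R => - v) (-1) by exact: is_deriveNid.
  have Drx x t (f : R -> R) d : is_derive v 1 f d -> is_derive v 1 (fun v => rotx x t (f v)) (- (roty x t (f v)) * d).
    move=> Df; apply: is_derive_eq (is_derive_sub (is_derive_mul (is_derive_const v 1 x) (is_derive_cos_comp Df))
      (is_derive_mul (is_derive_const v 1 t) (is_derive_sin_comp Df))) _; rewrite /roty; ring.
  have Dry x t (f : R -> R) d : is_derive v 1 f d -> is_derive v 1 (fun v => roty x t (f v)) (rotx x t (f v) * d).
    move=> Df; apply: is_derive_eq (is_derive_add (is_derive_mul (is_derive_const v 1 x) (is_derive_sin_comp Df))
      (is_derive_mul (is_derive_const v 1 t) (is_derive_cos_comp Df))) _; rewrite /rotx; ring.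
  have Di : is_derive v 1 (fun v : R => v) 1 by exact: is_derive_id.
  by have [] := is_derive_sub (is_derive_mul (is_derive_const v 1 2) Di) (is_derive_sub
    (is_derive_twist (b1 a a1) (Drx X1 T1 _ _ Dm) (Dry X1 T1 _ _ Dm))
    (is_derive_twist (b2 a a2) (Drx X2 T2 _ _ Di) (Dry X2 T2 _ _ Di))).
have hc : {within `[- pi, pi], continuous h}.
  apply: continuous_subspaceT => v; apply: differentiable_continuous.
  exact/derivable1_diffP/Dh.
have pile : - pi <= pi :> R by rewrite (@le_trans _ _ 0)// ?oppr_le0 ltW.
(* Since |n1 - n2| <= 2 pi, h is nonpositive at - pi and nonnegative at pi. *)
have [|v _ hv] := IVT pile hc (v := 0).
  have := n1_le pi; have := n2_le pi; have := n1_le (- pi); have := n2_le (- pi).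
  rewrite !ler_norml => /andP[q1 q2] /andP[q3 q4] /andP[q5 q6] /andP[q7 q8].
  have m1 : h (- pi) <= 0 by rewrite /h; lra.
  have m2 : 0 <= h pi by rewrite /h; lra.
  by rewrite ge_min m1 le_max m2 orbT.
pose p : V := mk4 (rotx X1 T1 (- v)) (rotx X2 T2 v) (roty X1 T1 (- v)) (roty X2 T2 v).
exists p; have s1E : s1 p = u1 by rewrite /s1 !mk4E hyp_rot.
have s2E : s2 p = u2 by rewrite /s2 !mk4E hyp_rot.
have nuE : nu a a1 a2 p = v.
  by move: hv; rewrite /nu !mk4E -/(n1 v) -/(n2 v) /h; lra.
have k1E : k1 a p = K u1 by rewrite /k1 s1E s2E uS.
have k2E : k2 a p = K u2 by rewrite /k2 s1E s2E uS.
have [k1n k2n] : K u1 != 0 /\ K u2 != 0 by split; rewrite gt_eqF// K0.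
have back x t w : (rotx (rotx x t w) (roty x t w) (- w) = x) * (roty (rotx x t w) (roty x t w) (- w) = t).
  by have [-> ->] := rot_rot x t w (- w); rewrite subrr; have [-> ->] := rot0 x t.
have back' x t w : (rotx (rotx x t (- w)) (roty x t (- w)) w = x) * (roty (rotx x t (- w)) (roty x t (- w)) w = t).
  by have := back x t (- w); rewrite opprK.
apply: c4_inj => [] [|[|[|[|//]]]] _; rewrite mk4E nuE ?k1E ?k2E !mk4E -/(rotx _ _ _) -/(roty _ _ _).
- by rewrite back' mulrC divfK.
- by rewrite back mulrC divfK.
- by rewrite back' mulrC divfK.
- by rewrite back mulrC divfK.
Qed.

Lemma open_ball4 (r : R) : open (ball4 r).
Proof.
have Uo := @openT V.
rewrite (_ : ball4 r = (fun z : V => pi * \sum_(i < 4) z ord0 i ^+ 2) @^-1` [set x | x < r])//.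
apply: open_comp => [z _|]; last exact: open_lt.
apply: (@Ck_continuous _ _ setT 0%N) => //.
apply: (CkM Uo); first exact: (Ck_cst Uo).
by apply: (Ck_sum Uo) => i; apply: (CkM Uo); exact: (Ck_coord _ _ Uo).
Qed.

(** At a preimage of z, s1 + s2 = 2 a / (a - pi |z|^2), which is bounded as long as z stays away
    from the sphere. *)
Lemma ball_chart_bounded y : ball4 a y ->
  exists M, \forall z \near y, forall p, FB p = z -> `|p| <= M.
Proof.
move=> yB; have yB' : pi * \sum_(i < 4) y ord0 i ^+ 2 < a by [].
(* The midpoint of pi |y|^2 and a, so [ball4 e] is a neighbourhood of y on which the quotient is at
   most 2 a / (a - e). *)
pose e := (a + pi * \sum_(i < 4) y ord0 i ^+ 2) / 2.
have ea : e < a by rewrite /e; lra.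
exists (2 * a / (a - e)).
have ye : ball4 e y by rewrite /ball4 /= /e; lra.
apply: filterS (open_nbhs_nbhs (conj (@open_ball4 e) ye)) => z ze p pz.
have {}ze : pi * \sum_(i < 4) z ord0 i ^+ 2 < e by [].
apply: le_trans (norm_chart p) _; have := ball_chart_size p; rewrite pz.
have S0 : 0 < s1 p + s2 p by rewrite addr_gt0 ?hyp_gt0.
move=> <-; rewrite ler_pdivlMr ?subr_gt0// ler_pM2l//; lra.
Qed.

End BallChart.

(** * The diamond as a union of open boxes *)

Section Diamond.
Variables (R : realType) (a a1 a2 : R).
Hypotheses (a_gt0 : 0 < a) (a1P : 0 <= a1 <= a) (a2P : 0 <= a2 <= a).

(** The open box of convex combinations with weight r on the horizontal segment and 1 - r on the
    vertical one, seen from (a1, a2). *)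
Definition slab (r : R) (q : R * R) := [/\ - (r * a1) < q.1 - a1, q.1 - a1 < r * (a - a1),
  - ((1 - r) * a2) < q.2 - a2 & q.2 - a2 < (1 - r) * (a - a2)].

Let hull : set (R * R) := [set q | exists r, [/\ 0 <= r <= 1, - (r * a1) <= q.1 - a1,
  q.1 - a1 <= r * (a - a1), - ((1 - r) * a2) <= q.2 - a2 & q.2 - a2 <= (1 - r) * (a - a2)]].

Let cross := [set p : R * R | 0 <= p.1 <= a /\ p.2 = a2] `|`
             [set p : R * R | p.1 = a1 /\ 0 <= p.2 <= a].

Lemma conv_cross_sub : conv2 cross `<=` hull.
Proof.
move=> q; apply; split.
- move=> p p' t [r [/andP[r0 r1] h1 h2 h3 h4]] [r' [/andP[r0' r1'] h1' h2' h3' h4']] t0 t1.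
  (* Every inequality defining [hull] is affine in the point and the weight together, so its slack
     is averaged. *)
  have comb (u v : R) : 0 <= u -> 0 <= v -> 0 <= t * u + (1 - t) * v.
    by move=> u0 v0; rewrite addr_ge0// mulr_ge0// subr_ge0.
  exists (t * r + (1 - t) * r'); split => /=.
  + apply/andP; split; first exact: comb.
    have := comb (1 - r) (1 - r'); rewrite !subr_ge0 => /(_ r1 r1'); lra.
  + have := comb (p.1 - a1 + r * a1) (p'.1 - a1 + r' * a1).
    by move=> H; have := H ltac:(lra) ltac:(lra); lra.
  + have := comb (r * (a - a1) - (p.1 - a1)) (r' * (a - a1) - (p'.1 - a1)).
    by move=> H; have := H ltac:(lra) ltac:(lra); lra.
  + have := comb (p.2 - a2 + (1 - r) * a2) (p'.2 - a2 + (1 - r') * a2).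
    by move=> H; have := H ltac:(lra) ltac:(lra); lra.
  + have := comb ((1 - r) * (a - a2) - (p.2 - a2)) ((1 - r') * (a - a2) - (p'.2 - a2)).
    by move=> H; have := H ltac:(lra) ltac:(lra); lra.
- move=> [u v] [[/= /andP[u0 ua] ->]|[/= -> /andP[v0 va]]].
  + by exists 1; split => /=; rewrite ?ler01 ?lexx//; lra.
  + by exists 0; split => /=; rewrite ?ler01 ?lexx//; lra.
Qed.

(** The box has side lengths r a and (1 - r) a, both positive as soon as it contains a point. *)
Lemma slab_bounds r q : slab r q -> 0 < r < 1.
Proof.
move=> [h1 h2 h3 h4]; apply/andP; split.
  by rewrite -(pmulr_lgt0 _ a_gt0); lra.
by rewrite -subr_gt0 -(pmulr_lgt0 _ a_gt0); lra.
Qed.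

Lemma slab_sub_conv r q : slab r q -> conv2 cross q.
Proof.
move=> sq; have /andP[r0 r1] := slab_bounds sq; have r1' : 0 < 1 - r by rewrite subr_gt0.
have [h1 h2 h3 h4] := sq; move=> C [/= cC crC].
have -> : q = (r * (a1 + (q.1 - a1) / r, a2).1 + (1 - r) * (a1, a2 + (q.2 - a2) / (1 - r)).1,
    r * (a1 + (q.1 - a1) / r, a2).2 + (1 - r) * (a1, a2 + (q.2 - a2) / (1 - r)).2).
  by rewrite [LHS]surjective_pairing /=; congr (_, _); field; exact: lt0r_neq0.
apply: cC; try exact: ltW.
- apply: crC; left => /=; split => //; apply/andP; split.
    by rewrite -lerBlDl sub0r ler_pdivlMr//; lra.
  by rewrite -lerBrDl ler_pdivrMr//; lra.
- apply: crC; right => /=; split => //; apply/andP; split.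
    by rewrite -lerBlDl sub0r ler_pdivlMr//; lra.
  by rewrite -lerBrDl ler_pdivrMr//; lra.
Qed.

Lemma open_itv_nbhs (l x u : R) : l < x -> x < u -> nbhs x [set y | l < y < u].
Proof.
move=> lx xu; have /near_in_itvoo : x \in `]l, u[ by rewrite in_itv /= lx.
by apply: filterS => y; rewrite in_itv.
Qed.

(** An interior point q can be pushed slightly away from an inner point m without leaving the hull;
    contracting back towards m makes all inequalities strict. Conversely, each slab is open and lies
    in the hull. *)
Lemma diamondP q : diamond a a1 a2 q <-> exists r, slab r q.
Proof.
split=> [|[r sq]].
  rewrite /diamond /interior /= => /nbhs_ballP[e /= e0 qe].
  have e0' : 0 < e by [].
  (* The midpoint of (a1, a2) and (a / 2, a / 2), which lies strictly inside the slab of weight 1 /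
     2. *)
  pose m1 := a1 + (a / 2 - a1) / 2; pose m2 := a2 + (a / 2 - a2) / 2.
  pose d := e / (1 + `|q.1 - m1| + `|q.2 - m2|).
  have n1 := normr_ge0 (q.1 - m1); have n2 := normr_ge0 (q.2 - m2).
  have D0 : 0 < 1 + `|q.1 - m1| + `|q.2 - m2| by lra.
  have d0 : 0 < d by rewrite divr_gt0.
  have small (y : R) : `|y| < 1 + `|q.1 - m1| + `|q.2 - m2| -> `|d * y| < e.
    by move=> hy; rewrite normrM gtr0_norm// /d mulrAC ltr_pdivrMr// ltr_pM2l.
  have := conv_cross_sub (qe (q.1 + d * (q.1 - m1), q.2 + d * (q.2 - m2)) _).
  case.
    split; rewrite /= -ball_normE /ball_/= opprD addrA subrr sub0r normrN; apply: small; lra.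
  move=> r [/andP[r0 r1] /= h1 h2 h3 h4].
  have d1 : 0 < 1 + d by rewrite addr_gt0.
  (* The average of r and 1 / 2 with the weights 1 : d that recover q from the pushed point and
     m. *)
  pose r' := (r + d / 2) / (1 + d).
  have rE : r' * (1 + d) = r + d / 2 by rewrite divfK// gt_eqF.
  have da : 0 < d * a by rewrite mulr_gt0.
  exists r'; split; rewrite -(ltr_pM2r d1).
  - have := congr1 ( *%R^~ a1) rE; rewrite /m1 in h1; lra.
  - have := congr1 ( *%R^~ (a - a1)) rE; rewrite /m1 in h2; lra.
  - have := congr1 ( *%R^~ a2) rE; rewrite /m2 in h3; lra.
  - have := congr1 ( *%R^~ (a - a2)) rE; rewrite /m2 in h4; lra.
have [h1 h2 h3 h4] := sq.
apply: filterS (@slab_sub_conv r) _.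
exists ([set u | - (r * a1) + a1 < u < r * (a - a1) + a1],
        [set v | - ((1 - r) * a2) + a2 < v < (1 - r) * (a - a2) + a2]) => /=.
  by split; apply: open_itv_nbhs; lra.
move=> [u v] [/= /andP[? ?] /andP[? ?]]; split => /=; lra.
Qed.
End Diamond.

(** * The diamond chart is a bijection onto the product with locally bounded inverse *)

Section DiamondChart.
Variables (R : realType) (a a1 a2 : R).
Hypotheses (a_gt0 : 0 < a) (a1P : 0 <= a1 <= a) (a2P : 0 <= a2 <= a).
Local Notation V := 'rV[R]_4.
Local Notation FU := (diamond_chart a a1 a2).
Local Notation b1 := (b1 a a1).
Local Notation b2 := (b2 a a2).

Lemma diamond_chart_in p : diamond_x_square a a1 a2 (FU p).
Proof.
have s10 : 0 < s1 p := hyp_gt0 _ _; have s20 : 0 < s2 p := hyp_gt0 _ _.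
have S0 := addr_gt0 s10 s20.
have h1 : `|c4 p 0| < s1 p := ltr_norm_hyp _ _; have h2 : `|c4 p 1| < s2 p := ltr_norm_hyp _ _.
move: h1 h2; rewrite !ltr_norml => /andP[l1 u1] /andP[l2 u2].
have aa (c s x : R) : a / 2 * (((1 - 2 * c / a) * s + x) / (s1 p + s2 p)) * (s1 p + s2 p) =
    (a / 2 - c) * s + a / 2 * x by field; rewrite !lt0r_neq0.
split; rewrite !mk4E.
  (* The weight s1 / (s1 + s2) turns the slab inequalities into |x_i| < s_i. *)
  apply/(diamondP a1 a2 a_gt0); exists (s1 p / (s1 p + s2 p)).
  have rE : s1 p / (s1 p + s2 p) * (s1 p + s2 p) = s1 p by rewrite divfK// gt_eqF.
  have m1 : 0 < a * (s1 p + c4 p 0) by rewrite mulr_gt0//; lra.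
  have m2 : 0 < a * (s1 p - c4 p 0) by rewrite mulr_gt0//; lra.
  have m3 : 0 < a * (s2 p + c4 p 1) by rewrite mulr_gt0//; lra.
  have m4 : 0 < a * (s2 p - c4 p 1) by rewrite mulr_gt0//; lra.
  have E1 := aa a1 (s1 p) (c4 p 0); have E2 := aa a2 (s2 p) (c4 p 1).
  have ra1 := congr1 ( *%R^~ a1) rE; have ra2 := congr1 ( *%R^~ a2) rE; have ra := congr1 ( *%R^~ a) rE.
  move: ra1 ra2 ra E1 E2; rewrite /b1 /b2 /=.
  set r := s1 p / _; set e1 := _ / 2 * (_ / _); set e2 := _ / 2 * (_ / _) => ra1 ra2 ra E1 E2.
  by split; rewrite -(ltr_pM2r S0) /=; lra.
have pi0 : 0 < pi :> R := pi_gt0 R.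
have Y (t : R) : 0 < 1 / 2 + atan t / pi < 1.
  have l := atan_gtNpi2 t; have u := atan_ltpi2 t.
  have l' : - (1 / 2) < atan t / pi by rewrite ltr_pdivlMr//; lra.
  have u' : atan t / pi < 1 / 2 by rewrite ltr_pdivrMr//; lra.
  by apply/andP; split; lra.
by split; apply: Y.
Qed.

(* Here [l] is the dilation factor [1 / (s1 + s2)]: for a fixed image point, [l s] increases with [l]. *)
Lemma dilation_diff (b x s x' s' L l l' : R) :
  s ^+ 2 = x ^+ 2 + L -> s' ^+ 2 = x' ^+ 2 + L -> l * (b * s + x) = l' * (b * s' + x') ->
  (l' * s' - l * s) * (l' * (s' + b * x') + l * (s + b * x)) = (l' ^+ 2 - l ^+ 2) * L.
Proof.
move=> sE sE' E.
have x'E : l' * x' = l * (b * s + x) - l' * b * s' by rewrite E; ring.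
have e' : l' ^+ 2 * L = (l' * s') ^+ 2 - (l' * x') ^+ 2 by rewrite !exprMn sE'; ring.
have e : l ^+ 2 * L = (l * s) ^+ 2 - (l * x) ^+ 2 by rewrite !exprMn sE; ring.
rewrite (_ : l' * (s' + b * x') = l' * s' + b * (l' * x')); last ring.
by rewrite [RHS]mulrBl e' e x'E; ring.
Qed.

(** In [dilation_diff] the right side and the second factor are positive, hence so is the first
    factor. *)
Lemma dilation_mono (b x s x' s' L l l' : R) : -1 <= b <= 1 -> `|x| < s -> `|x'| < s' ->
  s ^+ 2 = x ^+ 2 + L -> s' ^+ 2 = x' ^+ 2 + L -> 0 < L -> 0 < l -> l < l' ->
  l * (b * s + x) = l' * (b * s' + x') -> l * s < l' * s'.
Proof.
move=> hb xs xs' sE sE' L0 l0 ll' E.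
have q (y t : R) : `|y| < t -> 0 < t + b * y.
  move=> yt; have : `|b * y| < t.
    by apply: le_lt_trans yt; rewrite normrM ler_piMl// ler_norml.
  by rewrite ltr_norml; lra.
have l'0 : 0 < l' := lt_trans l0 ll'.
have P0 : 0 < l' * (s' + b * x') + l * (s + b * x) by rewrite addr_gt0// mulr_gt0// q.
rewrite -subr_gt0 -(pmulr_lgt0 _ P0).
rewrite (dilation_diff sE sE' E).
by rewrite mulr_gt0// subr_gt0 ltr_pXn2r// nnegrE ltW.
Qed.

(** The t_i are read off from the last coordinates. If the dilation factor l = 1 / (s1 + s2)
    differed, both l s_i would move strictly in the same direction although their sum is 1. For
    equal factors, [dilation_diff] with l = l' = 1 gives equal s_i, hence equal x_i. *)
Lemma diamond_chart_inj : injective FU.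
Proof.
move=> p q E; have pi0 : pi != 0 :> R by rewrite gt_eqF ?pi_gt0.
have C k := congr1 (fun z => c4 z k) E.
have T (u v : R) : 1 / 2 + atan u / pi = 1 / 2 + atan v / pi -> u = v.
  by move=> /addrI/(mulIf (_ : pi^-1 != 0)); rewrite invr_eq0 => /(_ pi0) h; rewrite -(atanK u) h atanK.
have T1 := C 2%N; have T2 := C 3%N; rewrite !mk4E in T1 T2.
move: T1 T2 => /T T1 /T T2.
have a20 : a / 2 != 0 by rewrite gt_eqF// divr_gt0.
have D1 := C 0%N; have D2 := C 1%N; rewrite !mk4E in D1 D2.
move: D1 D2 => /addrI/(mulfI a20) D1 /addrI/(mulfI a20) D2.
have Sp r : 0 < @s1 R r + s2 r by rewrite addr_gt0 ?hyp_gt0.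
have sqE (x t : R) : hyp x t ^+ 2 = x ^+ 2 + (1 + t ^+ 2) by rewrite sqr_hyp; ring.
have L0 (t : R) : 0 < 1 + t ^+ 2 by rewrite ltr_pwDl// sqr_ge0.
have mono p' q' : c4 p' 2 = c4 q' 2 -> c4 p' 3 = c4 q' 3 ->
    (b1 * s1 p' + c4 p' 0) / (s1 p' + s2 p') = (b1 * s1 q' + c4 q' 0) / (s1 q' + s2 q') ->
    (b2 * s2 p' + c4 p' 1) / (s1 p' + s2 p') = (b2 * s2 q' + c4 q' 1) / (s1 q' + s2 q') ->
    ~ (s1 q' + s2 q' < s1 p' + s2 p').
  move=> t1 t2; rewrite ![_ / (s1 p' + s2 p')]mulrC ![_ / (s1 q' + s2 q')]mulrC => d1 d2 lt.
  have ltV : (s1 p' + s2 p')^-1 < (s1 q' + s2 q')^-1 by rewrite ltf_pV2 ?posrE.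
  have i0 : 0 < (s1 p' + s2 p')^-1 by rewrite invr_gt0.
  have := dilation_mono (slope_bounds a_gt0 a1P) (ltr_norm_hyp _ _) (ltr_norm_hyp _ _)
    (sqE (c4 p' 0) (c4 p' 2)) (sqE _ _) (L0 _) i0 ltV.
  have := dilation_mono (slope_bounds a_gt0 a2P) (ltr_norm_hyp _ _) (ltr_norm_hyp _ _)
    (sqE (c4 p' 1) (c4 p' 3)) (sqE _ _) (L0 _) i0 ltV.
  rewrite -/(s1 p') -/(s2 p') t1 t2 -/(s1 q') -/(s2 q') => /(_ _ d2) h2 /(_ _ d1) h1.
  have := mulVf (lt0r_neq0 (Sp p')); have := mulVf (lt0r_neq0 (Sp q')).
  by move: h1 h2; rewrite /s1 /s2; move: (_^-1) (_^-1) => P Q; lra.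
have SE : s1 p + s2 p = s1 q + s2 q.
  by have [/(mono q p)|/(mono p q)|//] := ltgtP (s1 p + s2 p) (s1 q + s2 q) => [[]|[]].
have Si : (s1 q + s2 q)^-1 != 0 by rewrite invr_eq0 gt_eqF.
move: D1 D2; rewrite SE => /(mulIf Si) D1 /(mulIf Si) D2.
have eqs (b x x' t : R) : -1 <= b <= 1 -> b * hyp x t + x = b * hyp x' t + x' -> x = x'.
  move=> hb h; have h' : 1 * (b * hyp x t + x) = 1 * (b * hyp x' t + x') by rewrite h.
  have := dilation_diff (sqE x t) (sqE x' t) h'; rewrite subrr mul0r !mul1r => /eqP.
  have q0 : hyp x' t + b * x' + (hyp x t + b * x) != 0.
    by rewrite gt_eqF// addr_gt0// hyp_slope_gt0.
  rewrite mulf_eq0 (negPf q0) orbF subr_eq0 => /eqP e.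
  by move: h; rewrite e => /addrI.
apply: c4_inj => [] [|[|[|[|//]]]] _ //.
- by apply: (eqs b1 _ _ (c4 p 2)) => //; [exact: slope_bounds|rewrite {2}T1].
- by apply: (eqs b2 _ _ (c4 p 3)) => //; [exact: slope_bounds|rewrite {2}T2].
Qed.

(** The quadratic has leading coefficient k (1 - b^2) >= 0 and value - k d^2 <= 0 at zero, so it
    cannot decrease after becoming positive. *)
Lemma radicand_mono (k b d u v : R) : 0 <= k -> -1 <= b <= 1 -> 0 < u -> u <= v ->
  0 < k * (u ^+ 2 - (d - b * u) ^+ 2) ->
  k * (u ^+ 2 - (d - b * u) ^+ 2) <= k * (v ^+ 2 - (d - b * v) ^+ 2).
Proof.
move=> k0 /andP[bl bu] u0 uv; have [Qu _|Qu] := leP 0 (u ^+ 2 - (d - b * u) ^+ 2); last first.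
  by rewrite ltNge mulr_ge0_le0// ltW.
apply: ler_wpM2l => //; rewrite -subr_ge0 -(pmulr_rge0 _ u0).
have c0 : 0 <= (1 - b) * (1 + b) by rewrite mulr_ge0; lra.
have vu : 0 <= v - u by rewrite subr_ge0.
have v0 : 0 <= v by apply: le_trans uv; exact: ltW.
rewrite (_ : u * _ = (v - u) * (u ^+ 2 - (d - b * u) ^+ 2) +
  ((1 - b) * (1 + b) * (u * v) + d ^+ 2) * (v - u)); last ring.
by rewrite addr_ge0 ?mulr_ge0// addr_ge0 ?sqr_ge0// mulr_ge0// mulr_ge0// ltW.
Qed.

(* With [v = s1 / (s1 + s2)], both [Q1 z v] and [Q2 z (1 - v)] equal [(s1 + s2)^-2] at a chart point over z. *)
Let offset1 (z : V) : R := 2 * (c4 z 0 - a1) / a.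
Let offset2 (z : V) : R := 2 * (c4 z 1 - a2) / a.
Let angle1 (z : V) : R := pi * (c4 z 2 - 1 / 2).
Let angle2 (z : V) : R := pi * (c4 z 3 - 1 / 2).
Let Q1 (z : V) (v : R) : R := cos (angle1 z) ^+ 2 * (v ^+ 2 - (offset1 z - b1 * v) ^+ 2).
Let Q2 (z : V) (v : R) : R := cos (angle2 z) ^+ 2 * (v ^+ 2 - (offset2 z - b2 * v) ^+ 2).

Let Q1_mono z u v : 0 < u -> u <= v -> 0 < Q1 z u -> Q1 z u <= Q1 z v.
Proof. by move=> u0 uv; apply: radicand_mono => //; [exact: sqr_ge0|exact: slope_bounds]. Qed.

Let Q2_mono z u v : 0 < u -> u <= v -> 0 < Q2 z u -> Q2 z u <= Q2 z v.
Proof. by move=> u0 uv; apply: radicand_mono => //; [exact: sqr_ge0|exact: slope_bounds]. Qed.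

Lemma sqr_cos_atan (t : R) : cos (atan t) ^+ 2 * (1 + t ^+ 2) = 1.
Proof.
have t0 : 0 < 1 + t ^+ 2 by rewrite ltr_pwDl// sqr_ge0.
by rewrite cos_atan exprVn sqr_sqrtr ?ltW// mulVf// gt_eqF.
Qed.

(** The weight v = s1 / (s1 + s2) is found as a solution of Q1 z v = Q2 z (1 - v); the square root
    of the common value is 1 / (s1 + s2), and the preimage is then explicit. *)
Lemma diamond_chart_surj z : diamond_x_square a a1 a2 z -> exists p, FU p = z.
Proof.
move=> [/(diamondP a1 a2 a_gt0)[r sr] [/= /andP[y10 y11] /andP[y20 y21]]].
have /andP[r0 r1] := slab_bounds a_gt0 sr; have r1' : 0 < 1 - r by rewrite subr_gt0.
have pi0 : 0 < pi :> R := pi_gt0 R.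
have ang (y : R) : 0 < y -> y < 1 -> - (pi / 2) < pi * (y - 1 / 2) < pi / 2.
  by move=> l u; apply/andP; split; rewrite -subr_gt0;
    [rewrite (_ : _ - _ = pi * y)|rewrite (_ : _ - _ = pi * (1 - y))];
    rewrite ?mulr_gt0 ?subr_gt0//; move: (pi) => c; field.
have g1 := ang _ y10 y11; have g2 := ang _ y20 y21.
have sq (d b t : R) : - t < d - b * t -> d - b * t < t -> 0 < t ^+ 2 - (d - b * t) ^+ 2.
  move=> h1 h2; rewrite (_ : _ - _ = (t - (d - b * t)) * (t + (d - b * t))); last ring.
  by rewrite mulr_gt0; lra.
have [h1 h2 h3 h4] := sr.
have off (c x t : R) : 2 * (x - c) / a - (1 - 2 * c / a) * t = 2 * (x - c + t * c) / a - t.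
  by field; exact: lt0r_neq0.
(* The slab inequalities for z say exactly that the offset minus b1 r lies between - r and r. *)
have q1 : 0 < Q1 z r.
  rewrite mulr_gt0 ?exprn_gt0 ?cos_gt0_pihalf// sq//; rewrite /b1 off.
    by rewrite ltrDr divr_gt0// mulr_gt0//; move: h1; rewrite /=; lra.
  by rewrite ltrBlDr ltr_pdivrMr//; move: h2; rewrite /=; lra.
have q2 : 0 < Q2 z (1 - r).
  rewrite mulr_gt0 ?exprn_gt0 ?cos_gt0_pihalf// sq//; rewrite /b2 off.
    by rewrite ltrDr divr_gt0// mulr_gt0//; move: h3; rewrite /=; lra.
  by rewrite ltrBlDr ltr_pdivrMr//; move: h4; rewrite /=; lra.
have Q10 : Q1 z 0 <= 0.
  by rewrite /Q1 expr0n /= mulr0 subr0 sub0r mulrN oppr_le0 mulr_ge0// sqr_ge0.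
have Q20 : Q2 z 0 <= 0.
  by rewrite /Q2 expr0n /= mulr0 subr0 sub0r mulrN oppr_le0 mulr_ge0// sqr_ge0.
pose h v := Q1 z v - Q2 z (1 - v).
have hc : {within `[0, 1], continuous h}.
  apply: continuous_subspaceT => v.
  have Uo := @openT R; have cc c := @Ck_cst R R setT Uo 0%N c.
  have cv : Ck 0%N setT (fun v : R => v) by move=> ? _; exact: cvg_id.
  have cQ k d b (f : R -> R) : Ck 0%N setT f ->
      Ck 0%N setT (fun v => k * (f v ^+ 2 - (d - b * f v) ^+ 2)).
    move=> cf; apply: (CkM Uo) => //; apply: (CkD Uo); first exact: (Ck_sqr Uo).
    by apply: (CkN Uo); apply: (Ck_sqr Uo); apply: (CkD Uo) => //; apply: (CkN Uo); exact: (CkM Uo).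
  suff ch : Ck 0%N setT h by exact: ch.
  apply: (CkD Uo); first exact: cQ.
  by apply: (CkN Uo); apply: (cQ); apply: (CkD Uo) => //; exact: (CkN Uo).
have m0 : h 0 < 0.
  (* At 0 the first term is nonpositive, while Q2 z 1 >= Q2 z (1 - r) > 0; at 1 the roles are
     exchanged. *)
  rewrite /h subr0; have := @Q2_mono z _ _ r1' (_ : 1 - r <= 1) q2; rewrite gerBl ltW// => /(_ isT); lra.
have m1 : 0 < h 1.
  rewrite /h subrr; have := @Q1_mono z _ _ r0 (ltW r1) q1; lra.
have [|v /andP[v0 v1] hv] := IVT (@ler01 R) hc (v := 0).
  by rewrite ge_min ltW//= le_max (ltW m1) orbT.
have QE : Q2 z (1 - v) = Q1 z v by move: hv; rewrite /h; lra.
rewrite !bnd_simp in v0 v1.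
(* Either v >= r or 1 - v >= 1 - r, so monotonicity applies to one of the two equal values.
   Positivity then excludes v = 0 and v = 1. *)
have Qp : 0 < Q1 z v.
  have [rv|vr] := leP r v; first exact: lt_le_trans (Q1_mono r0 rv q1).
  by rewrite -QE; apply: lt_le_trans (Q2_mono r1' _ q2) => //; lra.
have {}v0 : 0 < v.
  by rewrite lt_def v0 andbT; apply: contraTneq Qp => ->; rewrite -leNgt.
have {}v1 : 0 < 1 - v.
  rewrite lt_def subr_ge0 v1 andbT; apply: contraTneq Qp => e.
  by rewrite -QE e -leNgt.
pose l := Num.sqrt (Q1 z v); have l0 : 0 < l by rewrite sqrtr_gt0.
have lE : l ^+ 2 = Q1 z v by rewrite sqr_sqrtr// ltW.
pose t1 := tan (angle1 z); pose t2 := tan (angle2 z).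
have at1 : atan t1 = angle1 z by rewrite /t1 tanK// in_itv.
have at2 : atan t2 = angle2 z by rewrite /t2 tanK// in_itv.
have H (w d b t : R) : 0 < w -> l ^+ 2 = cos (atan t) ^+ 2 * (w ^+ 2 - (d - b * w) ^+ 2) ->
    hyp ((d - b * w) / l) t = w / l.
  move=> w0 le; apply: hyp_uniq; first exact: divr_gt0.
  have : l ^+ 2 * (1 + t ^+ 2) = w ^+ 2 - (d - b * w) ^+ 2.
    by rewrite le mulrAC sqr_cos_atan mul1r.
  move=> e; rewrite (_ : (w / l) ^+ 2 = ((d - b * w) ^+ 2 + l ^+ 2 * (1 + t ^+ 2)) / l ^+ 2).
    by field; exact: lt0r_neq0.
  by rewrite e exprMn exprVn; congr (_ / _); ring.
pose p : V := mk4 ((offset1 z - b1 * v) / l) ((offset2 z - b2 * (1 - v)) / l) t1 t2.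
have s1E : s1 p = v / l by rewrite /s1 !mk4E; apply: H => //; rewrite lE at1.
have s2E : s2 p = (1 - v) / l by rewrite /s2 !mk4E; apply: H => //; rewrite lE at2 -QE.
have l0' := lt0r_neq0 l0; have a0' := lt0r_neq0 a_gt0; have pi0' := lt0r_neq0 pi0.
have sE : v / l + (1 - v) / l = l^-1 by field.
exists p; apply: c4_inj => [] [|[|[|[|//]]]] _; rewrite mk4E ?s1E ?s2E !mk4E ?at1 ?at2.
- by rewrite sE /offset1; field; rewrite a0' l0'.
- by rewrite sE /offset2; field; rewrite a0' l0'.
- by rewrite /angle1; move: (pi) pi0' => c c0; field.
- by rewrite /angle2; move: (pi) pi0' => c c0; field.
Qed.

(** The bracket reduces to (s^2 - x^2) / (s1 + s2)^2, and s^2 - x^2 = 1 + t^2 cancels against the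
    squared cosine of atan t. *)
Let Q_chart p : Q1 (FU p) (s1 p / (s1 p + s2 p)) = (s1 p + s2 p)^-1 ^+ 2 /\
  Q2 (FU p) (s2 p / (s1 p + s2 p)) = (s1 p + s2 p)^-1 ^+ 2.
Proof.
have S0 : 0 < s1 p + s2 p by rewrite addr_gt0 ?hyp_gt0.
have S0' := lt0r_neq0 S0; have a0' := lt0r_neq0 a_gt0; have pi0' := lt0r_neq0 (pi_gt0 R).
have A (t : R) : pi * (1 / 2 + atan t / pi - 1 / 2) = atan t.
  by move: (pi) pi0' => c c0; field.
have key (s x t d b : R) : s = hyp x t -> d = (b * s + x) / (s1 p + s2 p) ->
  cos (atan t) ^+ 2 * ((s / (s1 p + s2 p)) ^+ 2 - (d - b * (s / (s1 p + s2 p))) ^+ 2) =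
  (s1 p + s2 p)^-1 ^+ 2.
  move=> sE ->; rewrite (_ : _ - _ = (s ^+ 2 - x ^+ 2) * (s1 p + s2 p)^-1 ^+ 2); last first.
    by field; exact: S0'.
  rewrite sE sqr_hyp (_ : _ - _ = 1 + t ^+ 2); last ring.
  by rewrite mulrA sqr_cos_atan mul1r.
split; rewrite /Q1 /Q2 /angle1 /angle2 !mk4E A; apply: key => //.
  by rewrite /offset1 !mk4E; field; rewrite S0' a0'.
by rewrite /offset2 !mk4E; field; rewrite S0' a0'.
Qed.

(** With the weights u and u' of p0 frozen, Q1 z u and Q2 z u' stay above l / 2 near the image. Any
    preimage of z has one of its weights at least u or u', and monotonicity bounds (s1 + s2)^-2
    below by l / 2. *)
Lemma diamond_chart_bounded y : diamond_x_square a a1 a2 y ->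
  exists M, \forall z \near y, forall p, FU p = z -> `|p| <= M.
Proof.
move=> /diamond_chart_surj[p0 <-].
have Sp (p : V) : 0 < s1 p + s2 p by rewrite addr_gt0 ?hyp_gt0.
set u := s1 p0 / (s1 p0 + s2 p0); set u' := s2 p0 / (s1 p0 + s2 p0).
have [E1 E2] := Q_chart p0; rewrite -/u in E1; rewrite -/u' in E2.
have u0 : 0 < u by rewrite divr_gt0 ?hyp_gt0.
have u0' : 0 < u' by rewrite divr_gt0 ?hyp_gt0.
have uu : u + u' = 1 by rewrite -mulrDl divff// gt_eqF.
set l := (s1 p0 + s2 p0)^-1 ^+ 2 in E1 E2.
have l0 : 0 < l by rewrite exprn_gt0// invr_gt0.
exists (2 / l).
have Uo := @openT V.
have cc c := @Ck_cst R V setT Uo 0%N c; have cx j := @Ck_coord R 4 0%N setT (inord j) Uo.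
have cQ b c (i j : nat) v : Ck 0%N setT (fun z : V =>
   cos (pi * (c4 z j - 1 / 2)) ^+ 2 * (v ^+ 2 - (2 * (c4 z i - c) / a - b * v) ^+ 2)).
  apply: (CkM Uo).
    apply: (Ck_sqr Uo); apply: (Ck_sin_cos Uo _).2; apply: (CkM Uo) => //.
    by apply: (CkD Uo) => //; exact: cx.
  apply: (CkD Uo) => //; apply: (CkN Uo); apply: (Ck_sqr Uo); apply: (CkD Uo) => //.
  apply: (CkM Uo) => //; apply: (CkM Uo) => //; apply: (CkD Uo) => //; exact: cx.
have near_gt (f : V -> R) : Ck 0%N setT f -> f (FU p0) = l -> \forall z \near FU p0, l / 2 < f z.
  move=> cf fl; have nb : nbhs (f (FU p0)) [set r | l / 2 < r].
    by rewrite fl; apply: open_nbhs_nbhs; split; [exact: open_gt|rewrite /=; lra].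
  exact: (cf (FU p0) I _ nb).
have N1 := near_gt _ (cQ b1 a1 0%N 2%N u) E1; have N2 := near_gt _ (cQ b2 a2 1%N 3%N u') E2.
near=> z => p pz.
have n1 : l / 2 < Q1 z u by near: z.
have n2 : l / 2 < Q2 z u' by near: z.
have l20 : 0 < l / 2 by rewrite divr_gt0.
have [F1 F2] := Q_chart p; rewrite pz in F1 F2.
have vv : s1 p / (s1 p + s2 p) + s2 p / (s1 p + s2 p) = 1 by rewrite -mulrDl divff// gt_eqF.
have lS : l / 2 < (s1 p + s2 p)^-1 ^+ 2.
  have [le|gt] := leP u (s1 p / (s1 p + s2 p)).
    rewrite -F1; apply: (lt_le_trans n1); apply: Q1_mono => //; exact: (lt_trans l20 n1).
  rewrite -F2; apply: (lt_le_trans n2); apply: Q2_mono => //; first lra.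
  exact: (lt_trans l20 n2).
apply: le_trans (norm_chart p) _.
(* This allows s1 + s2 to be bounded by its square. *)
have S1 : 1 <= s1 p + s2 p by have := hyp_ge1 (c4 p 0) (c4 p 2); have := hyp_gt0 (c4 p 1) (c4 p 3); rewrite -/(s1 p) -/(s2 p); lra.
have : (s1 p + s2 p) ^+ 2 < 2 / l.
  by move: lS; rewrite -(invf_div 2 l) exprVn ltf_pV2// posrE ?exprn_gt0// divr_gt0.
by move=> /ltW; apply: le_trans; rewrite expr2 ler_peMl// ltW.
Unshelve. all: by end_near. Qed.

Lemma open_diamond_x_square : open (diamond_x_square a a1 a2).
Proof.
rewrite openE => z [zd zs]; rewrite /interior /=.
have cx j : {for z, continuous (fun z : V => c4 z j)} by exact: coord_continuous.
have N1 : nbhs z [set w | diamond a a1 a2 (c4 w 0, c4 w 1)].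
  have nb : nbhs (c4 z 0, c4 z 1) (diamond a a1 a2).
    by apply: open_nbhs_nbhs; split=> //; exact: open_interior.
  exact: (cvg_pair (cx 0%N) (cx 1%N) nb).
have N2 k : 0 < c4 z k < 1 -> nbhs z [set w | 0 < c4 w k < 1].
  by move=> /andP[h0 h1]; exact: (cx k _ (open_itv_nbhs h0 h1)).
have [z2 z3] := zs.
near=> w; split; [|split]; near: w => //; exact: N2.
Unshelve. all: by end_near. Qed.

End DiamondChart.

(** * The symplectomorphism as one chart composed with the inverse of the other *)

Theorem theorem3p1 (R : realType) (a a1 a2 : R) :
  0 < a -> 0 <= a1 <= a -> 0 <= a2 <= a ->
  symplectomorphic (diamond_x_square a a1 a2) (ball4 a).
Proof.
move=> a_gt0 a1P a2P.
pose U := diamond_x_square a a1 a2; pose V := ball4 a.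
pose F := diamond_chart a a1 a2; pose B := ball_chart a a1 a2.
(* Shared by both charts: a set-theoretic inverse is chosen, made continuous by local boundedness,
   and made smooth by the immersion property. *)
have inverse (C : 'rV[R]_4 -> 'rV[R]_4) (W : set 'rV[R]_4) :
    smooth_rV setT C -> injective C -> open W ->
    (forall p u, 'D_u C p = 0 -> u = 0) -> (forall z, W z -> exists p, C p = z) ->
    (forall y, W y -> exists M, \forall z \near y, forall p, C p = z -> `|p| <= M) ->
    exists G, (forall z, W z -> C (G z) = z) /\ smooth_rV W G.
  move=> Cs Ci Wo Cd Csurj Cb.
  have [G CG] : exists G, forall z, W z -> C (G z) = z.
    have /choice[G hG] : forall z, exists p, W z -> C p = z; last by exists G.
    (* The value 0 outside W is an arbitrary default. *)
    by move=> z; have [/Csurj[p Cp]|nWz] := pselect (W z); [exists p|exists 0].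
  exists G; split=> //; apply: (smooth_right_inverse Wo Cs Cd) => // y Wy.
  have [M hM] := Cb y Wy.
  have near_CG : \forall z \near y, C (G z) = z.
    by apply: filterS (open_nbhs_nbhs (conj Wo Wy)) => z; exact: CG.
  apply: (continuous_right_inverse (F := C) (M := M)) => //.
    by move=> p; apply: differentiable_continuous; exact: smooth_rV_differentiable Cs _.
  by near=> z; apply: (near hM z) => //; near: z.
have [GU [FG GUs]] := inverse F U (@smooth_diamond_chart _ a a1 a2) (diamond_chart_inj a_gt0 a1P a2P)
  (@open_diamond_x_square R a a1 a2) (diamond_chart_immersion a_gt0 a1P a2P)
  (diamond_chart_surj a_gt0 a1P a2P) (diamond_chart_bounded a_gt0 a1P a2P).
have [GB [BG GBs]] := inverse B V (smooth_ball_chart a1 a2 a_gt0) (ball_chart_inj a_gt0 a1P a2P)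
  (@open_ball4 R a) (ball_chart_immersion a_gt0 a1P a2P)
  (ball_chart_surj a_gt0 a1P a2P) (ball_chart_bounded a1 a2 a_gt0).
have GF p : GU (F p) = p.
  by apply: (diamond_chart_inj a_gt0 a1P a2P); apply: FG; exact: diamond_chart_in.
have GB' p : GB (B p) = p.
  by apply: (ball_chart_inj a_gt0 a1P a2P); apply: BG; exact: (ball_chart_in a1 a2 a_gt0).
have Uo : open U by exact: open_diamond_x_square.
exists (B \o GU), (F \o GB); split; [|split; [|split; [|split; [|split; [|split]]]]].
- by move=> x Ux; exact: (ball_chart_in a1 a2 a_gt0).
- by move=> y Vy; exact: diamond_chart_in.
- by move=> x Ux /=; rewrite GB' FG.
- by move=> y Vy /=; rewrite GF BG.
- by apply: smooth_on_rV => //; apply: (smooth_comp_rV (W := setT)) => //; exact: (smooth_ball_chart a1 a2 a_gt0).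
- apply: smooth_on_rV; first exact: open_ball4.
  by apply: (smooth_comp_rV (W := setT)) => //; [exact: open_ball4|exact: smooth_diamond_chart].
move=> x Ux u w.
have dG : differentiable GU x by exact: smooth_rV_differentiable GUs Ux.
have dB p : differentiable B p by exact: smooth_rV_differentiable (smooth_ball_chart a1 a2 a_gt0) _.
have dF p : differentiable F p by exact: smooth_rV_differentiable (@smooth_diamond_chart _ a a1 a2) _.
have chain (C : 'rV[R]_4 -> 'rV[R]_4) v : (forall p, differentiable C p) ->
    'D_v (C \o GU) x = 'D_('D_v GU x) C (GU x).
  move=> dC; have dCG := differentiable_comp dG (dC (GU x)).
  apply: (eq_trans (deriveE v dCG)).
  apply: (eq_trans (congr1 (@^~ v) (diff_comp dG (dC (GU x))))).
  apply: esym; apply: (eq_trans (deriveE ('D_v GU x) (dC (GU x)))).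
  exact: (congr1 ('d C (GU x)) (deriveE v dG)).
(* Differentiating F o [GU] = id near x; hence omega on the images under DB of the vectors
   ['D_v GU x] equals omega on the original vectors by [omega_charts]. *)
have FGid v : 'D_('D_v GU x) F (GU x) = v.
  rewrite -(chain F v dF); have nF : {near x, (id : 'rV[R]_4 -> 'rV[R]_4) =1 F \o GU}.
    by apply: filterS (open_nbhs_nbhs (conj Uo Ux)) => z Uz /=; rewrite FG.
  have did : differentiable (id : 'rV[R]_4 -> 'rV[R]_4) x by exact: ex_diff.
  have [dFG E] := is_diff_near_eq nF did.
  apply: (eq_trans (deriveE v dFG)); apply: (eq_trans (congr1 (@^~ v) E)).
  by apply: (eq_trans (esym (deriveE v did))); exact: derive_id.
by rewrite (chain B u dB) (chain B w dB) (omega_charts a1 a2 a_gt0) (FGid u) (FGid w).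
Unshelve. all: by end_near. Qed.
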